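(* There is an absolute constant $C>0$ such that, given any lacunary sequence $\{n_j\}_{j\in\mathbb N}\subset\mathbb N$, there exists a sequence of positive functions $\{f_k\}_{k\in\mathbb N}\subset L^\infty(\mathbb T)$ with the following properties: (1) $\|f_k\|_{L\log\log L}\approx 1$, i.e. there are constants $0<c\le c'<\infty$ independent of $k$ with $c\le \|f_k\|_{L\log\log L}\le c'$ for all $k$; (2) $\lim_{k\to\infty}\|f_k\|_{L\log\log L\,\log\log\log\log L}=\infty$; (3) for every $k\in\mathbb N$, $$\|C_{lac}^{\{n_j\}_j}(f_k)\|_{L^{1,\infty}}\ \ge\ C\,\|f_k\|_{L\log\log L\,\log\log\log\log L}.$$
   Context: $\mathbb T=\mathbb R/\mathbb Z$ is identified with $[0,1]$ (or $[-\tfrac12,\tfrac12]$) with Lebesgue measure $|\cdot|$; $\log=\log_2$. ''Positive function'' means $f\ge 0$ (not identically zero). A sequence $\{n_j\}_{j\in\mathbb N}\subset\mathbb N$ is lacunary if $\liminf_{j\to\infty} n_{j+1}/n_j>1$. The $\{n_j\}$-lacunary Carleson operator is $$C_{lac}^{\{n_j\}_j}f(x)=\sup_{j\in\mathbb N}\left|\int_{\mathbb T}e^{2\pi i n_j(x-y)}\cot(\pi(x-y))\,f(y)\,dy\right|,$$ the integral being taken in the principal value sense. $\|f\|_{1,\infty}=\|f\|_{L^{1,\infty}}=\sup_{\lambda>0}\lambda\,|\{x\in\mathbb T:|f(x)|>\lambda\}|$. For measurable $f$ on $\mathbb T$, $f^*(t)=\inf\{\lambda\ge0: |\{|f|>\lambda\}|\le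 t\}$ is its decreasing rearrangement. For a nondecreasing concave $\varphi:[0,1]\to[0,\infty)$ with $\varphi(0)=0$, the Lorentz space $\Lambda_\varphi$ consists of all measurable $f$ with $\|f\|_{\Lambda_\varphi}=\int_0^1 f^*(s)\,d\varphi(s)<\infty$. $L\log\log L$ denotes $\Lambda_\mu$ with $\mu(s)=s\log\log\frac4s$, and $L\log\log L\,\log\log\log\log L$ denotes $\Lambda_{\varphi_0}$ with $\varphi_0(s)=s\,\log\log\frac{17}{s}\,\log\log\log\log\frac{17}{s}$ (both functions being $0$ at $s=0$). Away from $0$, where these formulas may fail to be monotone or concave, they are replaced by any nondecreasing concave functions on $[0,1]$ which agree with them near $0$; different choices give equivalent norms. *)

(* Defs.v *)
From HB Require Import structures.
From mathcomp Require Export all_boot all_order all_algebra complex.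
From mathcomp Require Export all_classical all_reals all_analysis.
Export Order.TTheory GRing.Theory Num.Theory.
Export numFieldNormedType.Exports.

Set Implicit Arguments.
Unset Strict Implicit.
Unset Printing Implicit Defensive.

Local Open Scope classical_set_scope.
Local Open Scope ring_scope.
Local Open Scope complex_scope.

(* The circle R/Z is [0, 1] with Lebesgue measure; functions on it are
   1-periodic functions on R. *)

Definition periodic1 (R : realType) (f : R -> R) := forall x, f (x + 1) = f x.

Definition torus_measure (R : realType) :
    {measure set (measurableTypeR R) -> \bar R} :=
  mrestr lebesgue_measure
    (measurable_itv `[0, 1]%R : measurable (`[0, 1]%classic : set R)).

(* A nonnegative representative which is not the zero class. *)
Definition positive_function (R : realType) (f : R -> R) :=
  (forall x, 0 <= f x) /\ (0 < torus_measure R [set x | f x != 0%R])%E.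

(* The liminf is extended-real, as it may be +oo. Since x / 0 = 0, it forces
   n j != 0 for all large j. *)
Definition lacunary (R : realType) (n : nat -> nat) :=
  (1 < limn_einf (fun j => ((n j.+1)%:R / (n j)%:R : R)%:E))%E.

(* Principal value over the circle, with singularity at y = x mod 1: the set
   {y : dist(x - y, Z) <= e} is removed and e tends to 0 from the right.
   [lim] takes a dummy value where the limit does not exist; for the kernels
   below and integrable f this happens only on a null set of x. *)
Definition pv_integral (R : realType) (x : R) (g : R -> R) : R :=
  lim (\int[lebesgue_measure]_(y in
         [set y | 0 <= y <= 1 /\ forall m : int, e < `|x - y - m%:~R|]) g y
       @[e --> 0^'+]).

Definition pv_cintegral (R : realType) (x : R) (g : R -> R[i]) : R[i] :=
  pv_integral x (fun y => complex.Re (g y)) +i*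
  pv_integral x (fun y => complex.Im (g y)).

Definition cexpi (R : realType) (t : R) : R[i] := cos t +i* sin t.

Definition cot (R : realType) (t : R) : R := cos t / sin t.

Definition lac_carleson (R : realType) (n : nat -> nat) (f : R -> R) (x : R) :
    \bar R :=
  ereal_sup (range (fun j : nat =>
    (ComplexField.Normc.normc
      (pv_cintegral x (fun y =>
         cexpi (2 * pi * (n j)%:R * (x - y))
         * (cot (pi * (x - y)))%:C * (f y)%:C)))%:E)).

Definition weakL1_norm (R : realType) (g : R -> \bar R) : \bar R :=
  ereal_sup [set (l%:E * torus_measure R [set x | l%:E < `|g x|])%E |
             l in [set l : R | 0 < l]].

Definition decreasing_rearrangement (R : realType) (f : R -> R) (t : R) :
    \bar R :=
  ereal_inf [set l%:E | l in
    [set l : R | 0 <= l /\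
       (torus_measure R [set x | (l < `|f x|)%R] <= t%:E)%E]].

(* [phi] is nondecreasing, so with phi 0 = 0 it maps [0, 1] to [0, +oo[. It is
   given as a right-continuous function on the whole line, as the
   Lebesgue-Stieltjes measure requires; only its values on [0, 1] matter.
   Concavity is convexity of the opposite. *)
Definition lorentz_weight (R : realType) (phi : cumulative R R) :=
  phi 0 = 0 /\ convex_function (`[0, 1]%classic : set R^o) (fun s => - phi s).

Definition lorentz_norm (R : realType) (phi : cumulative R R) (f : R -> R) :
    \bar R :=
  (\int[lebesgue_stieltjes_measure phi]_(s in `]0%R, 1%R])
     decreasing_rearrangement f s)%E.

Definition log2 (R : realType) (x : R) : R := ln x / ln 2.

(* The formulas need not be monotone or concave on all of [0, 1]: phi is any
   admissible weight that agrees with them near 0. *)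
Definition weight_LloglogL (R : realType) (phi : cumulative R R) :=
  lorentz_weight phi /\
  \forall s \near 0^'+, phi s = s * log2 (log2 (4 / s)).

Definition weight_LloglogLloglogloglogL (R : realType) (phi : cumulative R R) :=
  lorentz_weight phi /\
  \forall s \near 0^'+,
    phi s = s * log2 (log2 (17 / s)) * log2 (log2 (log2 (log2 (17 / s)))).

(* Main.v *)
Require Import Defs.
From mathcomp Require Import measurable_realfun ess_sup_inf ring lra zify.

(** Why the theorem is true.

    For every large L there is one function f = sum_(i < N) h_i 1_(E_i), with
    N = 2^L layers of extremely different heights.  Put
    kappa_i = 2^((L + 2)(i + 1)).  Layer i has mass of order 1 / (N kappa_i),
    and log log h_i is of order kappa_i.  Hence each layer contributes about
    1 / N to the norm with weight s log log (4 / s), which is therefore of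
    order 1, and about (log log kappa_i) / N to the norm with the larger
    weight, which lies between constant multiples of log L and of L ([mu_sum],
    [phi_sum], [lorentz_norm_le], [lorentz_norm_ge]).  It remains to see that
    |C_lac f| is at least a constant times L on a set of measure bounded below.

    One layer.  Spread mass 1 over the even ones of 2K equal cells.  Seen from
    a point x of an odd cell, the kernel cot integrates the mass to about
    log K, provided that the mass on the left of x is counted with the opposite
    sign.  The modulation by a frequency n can do this: multiply the density at
    y by 1 + r(n y) if y is on the right of x and by 1 - r(n y) if y is on the
    left, where r is a square wave.  In the mean, r(n y) sin(2 pi n y) is
    2 / pi, and a density without such a factor is cancelled by the
    modulation.  Every cell u of points x gets a frequency of its own, so the
    density becomes a product of factors 1 +- r, one for each cell that has to
    see it; M factors multiply the height by 2^M and leave the mass unchanged.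
    About K factors are needed, so a gain of log K is paid by a double
    logarithm of the height of order log K.

    Many layers.  Let the cells be nested: an even cell is divided again, up to
    L times, and the mass sits in the innermost cells, while an odd cell is
    left to the next, finer, layers.  In an even cell of level l the density of
    mass is 2^l, on a set of measure 2^-l, so a point which leaves the nest at
    level l receives 2^l log K.  The same mass serves all levels.  Up to a
    constant factor, layer i contributes to |C_lac f| a variable 2^l / N with
    mean L / (2 N), because each of the L levels contributes 1 / (2 N).  The
    levels reached in different layers are independent, and by Chebyshev the
    sum of these variables is at least L / 4 with probability 1/2
    ([chebyshev_leaves]).

    A point has only one frequency, which must suit all layers at once.  The
    tree of cells ([tower]) takes care of this: the mass of layer i is
    constrained only by the leaves below the odd siblings of its ancestors in
    block i, and these are L K_i times the number of leaves of the finer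
    blocks, where K_i = 2^(kappa_i).  As kappa_i grows geometrically with ratio
    2^(L + 2), the logarithm of this number is still of order kappa_i
    ([tower_exists]).

    The frequencies are taken from the given sequence one after another, each
    so large that its wave is averaged against everything that was fixed
    before ([oscillatory_mean], [frequency_selection]).  Only finitely many
    averages are prescribed; continuity of the kernel away from its pole gives
    the lower bound at all points of the cells ([tower_bound]). *)

Local Open Scope classical_set_scope.
Local Open Scope ring_scope.

Set Implicit Arguments.
Unset Strict Implicit.
Unset Printing Implicit Defensive.

(** * Integrals of bounded measurable functions *)

Section bounded_measurable.
Variable R : realType.
Implicit Types (f g h : R -> R) (a b c x y : R).
Local Notation leb := (@lebesgue_measure R).

Definition bounded_measurable g :=
  measurable_fun [set: R] g /\ exists M, forall x, `|g x| <= M.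

Lemma bounded_measurable_integrable g (A : set R) :
  measurable A -> (leb A < +oo)%E -> bounded_measurable g ->
  leb.-integrable A (EFin \o g).
Proof.
move=> mA Afin [mg [M gM]]; apply: measurable_bounded_integrable => //.
  exact: measurable_funTS.
exists M; split; first exact: num_real.
by move=> x Mx y _ /=; exact: (le_trans (gM y) (ltW Mx)).
Qed.

Lemma bounded_measurable_itv g a b :
  bounded_measurable g -> leb.-integrable `[a, b] (EFin \o g).
Proof.
move=> bg; apply: bounded_measurable_integrable => //.
by rewrite /= lebesgue_measure_itv /=; case: ifP => // _; rewrite -EFinB ltry.
Qed.

Lemma bounded_measurable_cst c : bounded_measurable (cst c).
Proof. by split; [exact: measurable_cst | exists `|c|]. Qed.

Lemma bounded_measurableD f g : bounded_measurable f -> bounded_measurable g ->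
  bounded_measurable (fun x => f x + g x).
Proof.
move=> [mf [M fM]] [mg [N gN]]; split; first exact: measurable_funD.
exists (M + N) => x; rewrite (le_trans (ler_normD _ _))//.
exact: lerD.
Qed.

Lemma bounded_measurableM f g : bounded_measurable f -> bounded_measurable g ->
  bounded_measurable (fun x => f x * g x).
Proof.
move=> [mf [M fM]] [mg [N gN]]; split; first exact: measurable_funM.
by exists (M * N) => x; rewrite normrM ler_pM.
Qed.

Lemma bounded_measurable_indic (A : set R) :
  measurable A -> bounded_measurable (\1_A : R -> R).
Proof.
move=> mA; split; first exact: measurable_indic.
by exists 1 => x; rewrite indicE; case: (_ \in _); rewrite ?normr1 ?normr0.
Qed.

Lemma bounded_measurable_sum (I : Type) (s : seq I) (F : I -> R -> R) :
  (forall i, bounded_measurable (F i)) ->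
  bounded_measurable (fun x => \sum_(i <- s) F i x).
Proof.
move=> bF; elim: s => [|i s ih].
  by under eq_fun do rewrite big_nil; exact: bounded_measurable_cst.
by under eq_fun do rewrite big_cons; exact: bounded_measurableD.
Qed.

Lemma bounded_measurable_prod (I : Type) (s : seq I) (F : I -> R -> R) :
  (forall i, bounded_measurable (F i)) ->
  bounded_measurable (fun x => \prod_(i <- s) F i x).
Proof.
move=> bF; elim: s => [|i s ih].
  by under eq_fun do rewrite big_nil; exact: bounded_measurable_cst.
by under eq_fun do rewrite big_cons; exact: bounded_measurableM.
Qed.

Lemma RintegralD_itv f g a b : bounded_measurable f -> bounded_measurable g ->
  \int[leb]_(y in `[a, b]) (f y + g y) =
  \int[leb]_(y in `[a, b]) f y + \int[leb]_(y in `[a, b]) g y.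
Proof. by move=> *; rewrite RintegralD//; exact: bounded_measurable_itv. Qed.

Lemma RintegralZ_itv c g a b : bounded_measurable g ->
  \int[leb]_(y in `[a, b]) (c * g y) = c * \int[leb]_(y in `[a, b]) g y.
Proof. by move=> *; rewrite RintegralZl//; exact: bounded_measurable_itv. Qed.

Lemma RintegralB_itv f g a b : bounded_measurable f -> bounded_measurable g ->
  \int[leb]_(y in `[a, b]) (f y - g y) =
  \int[leb]_(y in `[a, b]) f y - \int[leb]_(y in `[a, b]) g y.
Proof. by move=> *; rewrite RintegralB//; exact: bounded_measurable_itv. Qed.

Lemma Rintegral_sum_itv (I : Type) (s : seq I) (F : I -> R -> R) a b :
  (forall i, bounded_measurable (F i)) ->
  \int[leb]_(y in `[a, b]) (\sum_(i <- s) F i y) =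
  \sum_(i <- s) \int[leb]_(y in `[a, b]) F i y.
Proof.
move=> bF; elim: s => [|i s ih].
  rewrite big_nil; under eq_Rintegral do rewrite big_nil.
  by rewrite Rintegral_cst// mul0r.
rewrite big_cons -ih -RintegralD_itv//; last exact: bounded_measurable_sum.
by apply: eq_Rintegral => y _; rewrite big_cons.
Qed.

Lemma Rintegral_itv_cst c a b : a <= b ->
  \int[leb]_(y in `[a, b]) c = c * (b - a).
Proof.
move=> ab; rewrite Rintegral_cst//= lebesgue_measure_itv/= lte_fin.
by move: ab; rewrite le_eqVlt => /predU1P[->|->//]; rewrite ltxx subrr.
Qed.

Lemma le_Rintegral_itv f g a b : bounded_measurable f -> bounded_measurable g ->
  (forall x, a <= x <= b -> f x <= g x) ->
  \int[leb]_(y in `[a, b]) f y <= \int[leb]_(y in `[a, b]) g y.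
Proof.
move=> bf bg fg; apply: le_Rintegral => //; try exact: bounded_measurable_itv.
Qed.

Lemma Rintegral_itv_le_bound g M a b : a <= b -> bounded_measurable g ->
  (forall x, a <= x <= b -> `|g x| <= M) ->
  `|\int[leb]_(y in `[a, b]) g y| <= M * (b - a).
Proof.
move=> ab bg gM.
have bM := bounded_measurable_cst M.
have bM' := bounded_measurable_cst (- M).
rewrite ler_norml -mulNr -!(Rintegral_itv_cst _ ab).
apply/andP; split; apply: le_Rintegral_itv => // x /gM;
  by rewrite ler_norml => /andP[].
Qed.

Lemma Rintegral_itv_split g a b c : a <= c -> c <= b ->
  leb.-integrable `[a, b] (EFin \o g) ->
  \int[leb]_(y in `[a, b]) g y =
  \int[leb]_(y in `[a, c]) g y + \int[leb]_(y in `[c, b]) g y.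
Proof.
move=> ac cb ig.
rewrite -[X in _ + X]Rintegral_itv_obnd_cbnd; last first.
  apply: integrableS ig => //; apply: subset_itv => //=; rewrite bnd_simp//.
by rewrite -(Rintegral_itvB ig) ?bnd_simp// addrC subrK.
Qed.

(** Heine's theorem, with only one of the two points in the interval, so that
    the other may stick out by a little. *)
Lemma continuous_itv_unif h a b : continuous h ->
  forall e : R, 0 < e -> exists2 d, 0 < d & forall x y, a <= x <= b ->
    `|x - y| < d -> `|h x - h y| < e.
Proof.
move=> ch e e0.
have /compact_near_coveringP cpt := @segment_compact R a b.
have := cpt R (0^'+ : set_system R)
  (fun d x => forall y, `|x - y| < d -> `|h x - h y| < e) _.
case.
- move=> x _.
  have /cvgrPdist_lt /(_ (e/2)) := ch x.
  rewrite divr_gt0// => /(_ isT) [r /= r0 hr].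
  near=> x' d => y /= xy.
  have hx' : `|h x - h x'| < e / 2.
    apply: hr => /=; near: x'.
    by exists (r) => //= z.
  have hy' : `|h x - h y| < e / 2.
    apply: hr => /=.
    have xx' : `|x - x'| < r / 2.
      near: x'; exists (r/2) => //=; by rewrite divr_gt0.
    have dr : d < r / 2 by near: d; apply: nbhs_right_lt; rewrite divr_gt0.
    have xy' := ler_distD x' x y; lra.
  have hxy := ler_distD (h x) (h x') (h y).
  by rewrite distrC in hx'; lra.
- move=> d /= d0 hd; exists (d/2); first by rewrite divr_gt0.
  move=> x y xab xy.
  apply: (hd (d/2)) => //=; rewrite ?in_itv//= ?divr_gt0//.
  by rewrite sub0r normrN gtr0_norm ?divr_gt0//; lra.
Unshelve. all: by end_near. Qed.

End bounded_measurable.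

(** * Averaging of fast oscillations *)

Section averaging.
Variable R : realType.
Implicit Types (f g h : R -> R) (a b c x y : R).
Local Notation leb := (@lebesgue_measure R).

(** On a block of length 1/n, on which h is almost constant, rho may be
    replaced by its mean beta; the error of the n blocks adds up to e. *)
Lemma block_average h (rho : R -> R) B beta e n : (0 < n)%N ->
  bounded_measurable h -> bounded_measurable rho ->
  (forall x, `|rho x| <= B) ->
  (forall x y, 0 <= x <= 1 -> `|x - y| <= n%:R^-1 -> `|h x - h y| <= e) ->
  (forall k, (k < n)%N -> \int[leb]_(y in `[k%:R / n%:R, k.+1%:R / n%:R]) rho y
     = beta / n%:R) ->
  `|\int[leb]_(y in `[0, 1]) (h y * (rho y - beta))| <= e * (B + `|beta|).
Proof.
move=> n0 bh brho rhoB he rhomean.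
have n0' : (0 : R) < n%:R by rewrite ltr0n.
have brho' : bounded_measurable (fun y => rho y - beta).
  exact: (bounded_measurableD _ (bounded_measurable_cst (- beta))).
have bhr : bounded_measurable (fun y => h y * (rho y - beta)).
  exact: bounded_measurableM.
suff H k : (k <= n)%N ->
    `|\int[leb]_(y in `[0, k%:R / n%:R]) (h y * (rho y - beta))| <=
    k%:R * (e * (B + `|beta|) / n%:R).
  have := H _ (leqnn n).
  by rewrite divff ?gt_eqF// mulrCA divff ?gt_eqF// mulr1.
elim: k => [|k ih] kn.
  by rewrite mul0r set_itv1 Rintegral_set1 normr0 mul0r.
have kk1 : k%:R / n%:R <= k.+1%:R / n%:R :> R.
  by rewrite ler_pM2r ?invr_gt0// ler_nat.
rewrite (@Rintegral_itv_split _ _ _ _ (k%:R / n%:R))//; last first.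
  exact: bounded_measurable_itv.
set C := e * (B + `|beta|) / n%:R.
have -> : k.+1%:R * C = k%:R * C + C by rewrite -natr1 mulrDl mul1r.
rewrite (le_trans (ler_normD _ _))// lerD//.
  exact/ih/ltnW.
(* Subtracting a constant from h does not change the integral, as rho - beta has
   mean 0 on the block. *)
set c := h (k%:R / n%:R).
have bhc : bounded_measurable (fun y => (h y - c) * (rho y - beta)).
  apply: bounded_measurableM => //.
  exact: (bounded_measurableD _ (bounded_measurable_cst (- c))).
have -> : \int[leb]_(y in `[k%:R / n%:R, k.+1%:R / n%:R]) (h y * (rho y - beta))
  = \int[leb]_(y in `[k%:R / n%:R, k.+1%:R / n%:R])
       ((h y - c) * (rho y - beta)).
  transitivity (\int[leb]_(y in `[k%:R / n%:R, k.+1%:R / n%:R])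
       ((h y - c) * (rho y - beta) + c * (rho y - beta))).
    by apply: eq_Rintegral => y _; ring.
  rewrite RintegralD_itv//; last first.
    exact: (bounded_measurableM (bounded_measurable_cst c)).
  rewrite RintegralZ_itv// RintegralB_itv//; last exact: bounded_measurable_cst.
  rewrite rhomean// Rintegral_itv_cst// -natr1.
  rewrite (_ : beta / n%:R - _ = 0) ?mulr0 ?addr0//.
  by field; rewrite gt_eqF.
have -> : C =
  e * (B + `|beta|) * (k.+1%:R / n%:R - k%:R / n%:R).
  by rewrite /C -natr1; field; rewrite gt_eqF.
apply: Rintegral_itv_le_bound => // y /andP[ky yk].
rewrite normrM ler_pM//.
- apply: he.
    rewrite (le_trans _ ky) ?divr_ge0//= (le_trans yk)//.
    by rewrite ler_pdivrMr// mul1r ler_nat.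
  rewrite ger0_norm ?subr_ge0//.
  by move: yk; rewrite -natr1 mulrDl mul1r; lra.
- rewrite (le_trans (ler_normB _ _))// lerD//.
Qed.

(** Riemann-Lebesgue: [block_average] is for continuous functions, and these
    are dense in the integrable ones. *)
Lemma oscillatory_mean g (rho : nat -> R -> R) B beta :
  bounded_measurable g ->
  (forall n, measurable_fun [set: R] (rho n)) ->
  (forall n x, `|rho n x| <= B) ->
  (forall n k, (k < n)%N ->
     \int[leb]_(y in `[k%:R / n%:R, k.+1%:R / n%:R]) rho n y = beta / n%:R) ->
  forall e : R, 0 < e -> \forall n \near \oo,
    `|\int[leb]_(y in `[0, 1]) (g y * rho n y)
      - beta * \int[leb]_(y in `[0, 1]) g y| <= e.
Proof.
move=> bg mrho rhoB rhomean e e0.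
have B0 : 0 <= B by exact: (le_trans (normr_ge0 _) (rhoB 0%N 0)).
pose D := B + `|beta| + 1.
have D0 : 0 < D by rewrite ltr_wpDl// addr_ge0.
have ed0 : 0 < e / D / 2 by rewrite !divr_gt0.
have [h0 ch0 gh0] : exists2 h : R -> R, continuous h &
    \int[leb]_(y in `[0, 1]) `|g y - h y| <= e / D / 2.
  have m01 : (leb `[0%R, 1%R] < +oo)%E.
    by rewrite lebesgue_measure_itv/= lte_fin ltr01 -EFinB ltry.
  have [] := @approximation_continuous_integrable R `[0, 1]%classic g _ m01 _ => //.
    exact: bounded_measurable_itv.
  move=> g_ [cg ig]/fine_cvgP[_] /cvgrPdist_le /(_ _ ed0)[n _ /(_ n (leqnn n))].
  rewrite /= sub0r normrN ger0_norm; last by apply: Rintegral_ge0.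
  by move=> le_n; exists (g_ n).
(* The approximating function is bounded only on [0, 1]; it is extended by its
   values at the end points. *)
pose cl x := Num.max 0 (Num.min x 1) : R.
have ccl : continuous cl.
  move=> x; apply: (@continuous_max _ _ (cst 0) (fun x => Num.min x 1)).
    exact: cvg_cst.
  by apply: (@continuous_min _ _ id (cst 1)); [exact: cvg_id|exact: cvg_cst].
have cl01 x : 0 <= cl x <= 1.
  rewrite /cl le_max lexx/= ge_max ler01/= ge_min lexx orbT//.
have clE x : 0 <= x <= 1 -> cl x = x.
  by move=> /andP[x0 x1]; rewrite /cl min_l// max_r.
pose h := h0 \o cl.
have ch : continuous h by move=> x; apply: continuous_comp; [exact: ccl|exact: ch0].
have bh : bounded_measurable h.
  split; first exact: continuous_measurable_fun.
  have : {within `[0, 1], continuous (fun x => `|h0 x|)}.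
    apply: continuous_subspaceT => x; apply: continuous_comp; first exact: ch0.
    exact: norm_continuous.
  case/(EVT_max ler01) => c _ hc; exists `|h0 c| => x.
  by apply: hc; rewrite in_itv/= cl01.
have gh : \int[leb]_(y in `[0, 1]) `|g y - h y| <= e / D / 2.
  rewrite (le_trans _ gh0)// le_eqVlt; apply/orP; left; apply/eqP.
  apply: eq_Rintegral => y; rewrite inE/= in_itv/= => y01.
  by rewrite /h/= clE.
have [d d0 hd] := continuous_itv_unif 0 1 ch ed0.
have brho n : bounded_measurable (rho n) by split => //; exists B.
exists (Num.truncn d^-1).+1 => // n /= dn.
have n0 : (0 < n)%N by exact: leq_trans dn.
have nd : n%:R^-1 < d.
  rewrite invf_plt ?posrE ?ltr0n//.
  by rewrite (lt_le_trans (truncnS_gt _))// ler_nat.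
have := @block_average h (rho n) B beta (e/D/2) n n0 bh (brho n) (rhoB n) _ (rhomean n).
have h1 : forall x y, 0 <= x <= 1 -> `|x - y| <= n%:R^-1 -> `|h x - h y| <= e/D/2.
  by move=> x y x01 xy; apply/ltW/hd => //; exact: le_lt_trans nd.
move=> /(_ h1) {}h1.
pose s y := rho n y - beta.
have bs : bounded_measurable s.
  exact: (bounded_measurableD _ (bounded_measurable_cst (- beta))).
have bgh : bounded_measurable (fun y => g y - h y).
  apply: bounded_measurableD => //.
  by have := bounded_measurableM (bounded_measurable_cst (-1)) bh;
     under eq_fun do rewrite mulN1r.
have -> : \int[leb]_(y in `[0, 1]) (g y * rho n y)
      - beta * \int[leb]_(y in `[0, 1]) g y =
  \int[leb]_(y in `[0, 1]) ((g y - h y) * s y) +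
  \int[leb]_(y in `[0, 1]) (h y * s y).
  rewrite -RintegralD_itv; [|exact: bounded_measurableM..].
  rewrite -RintegralZ_itv// -RintegralB_itv; [|exact: bounded_measurableM|
    exact: (bounded_measurableM (bounded_measurable_cst _))].
  by apply: eq_Rintegral => y _; rewrite /s; ring.
rewrite (le_trans (ler_normD _ _))//.
have ngh : bounded_measurable (fun y => `|g y - h y|).
  case: bgh => mgh [M ghM]; split; first exact: measurableT_comp.
  by exists M => x; rewrite normr_id.
have DB : B + `|beta| <= D by rewrite lerDl.
have h2 : `|\int[leb]_(y in `[0, 1]) ((g y - h y) * s y)| <= D * (e/D/2).
  apply: (le_trans (le_normr_Rintegral _ _)) => //.
    exact/bounded_measurable_itv/bounded_measurableM.
  apply: (@le_trans _ _ (\int[leb]_(y in `[0, 1]) (D * `|g y - h y|))).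
    apply: le_Rintegral_itv.
    - have [m [M hM]] := bounded_measurableM bgh bs.
      by split; [exact: measurableT_comp | exists M => x; rewrite normr_id].
    - exact: (bounded_measurableM (bounded_measurable_cst D)).
    move=> x _; rewrite normrM mulrC ler_pM//.
    by rewrite (le_trans _ DB)// (le_trans (ler_normB _ _))// lerD.
  by rewrite RintegralZ_itv// ler_pM2l.
have h3 : e / D / 2 * (B + `|beta|) <= D * (e/D/2).
  by rewrite mulrC ler_pM2r.
have <- : D * (e/D/2) + D * (e/D/2) = e by field; rewrite gt_eqF.
by rewrite lerD// (le_trans h1).
Qed.

End averaging.

(** * Square waves, test waves and the choice of frequencies *)

Section waves.
Variable R : realType.
Implicit Types (f g h : R -> R) (a b c x y : R).
Local Notation leb := (@lebesgue_measure R).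

Definition frac_part x : R := x - (Num.floor x)%:~R.

(** A two-valued wave keeps the layers two-valued: a product of factors
    1 +- r is 0 or a power of 2, which makes the rearrangements explicit. *)
Definition square_wave x : R := if frac_part x < 2^-1 then 1 else -1.

(** [Some true] stands for the sign +, [Some false] for - and [None] for the
    absence of a factor. *)
Definition sgn_of (s : option bool) : R :=
  if s is Some b then (if b then 1 else -1) else 0.

(** The factors of all products that have to be averaged: the modulation, if
    [w.1], times the factor 1 +- r of the density. *)
Definition test_wave (w : bool * option bool) (n : nat) y : R :=
  (if w.1 then sin (2 * pi * n%:R * y) else 1) *
  (1 + sgn_of w.2 * square_wave (n%:R * y)).

(** 2 / pi is the mean of r(t) sin(2 pi t) = |sin(2 pi t)|. *)
Definition test_mean (w : bool * option bool) : R :=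
  if w.1 then sgn_of w.2 * (2 / pi) else 1.

Lemma frac_part_itv (k : nat) x : k%:R <= x < k.+1%:R -> frac_part x = x - k%:R.
Proof.
move=> kx; rewrite /frac_part (_ : Num.floor x = k%:Z)//.
by apply: floor_def; rewrite -[(k%:Z + 1)%R]/(k%:Z + 1%:Z) -PoszD addn1.
Qed.

Lemma frac_partD1 x : frac_part (x + 1) = frac_part x.
Proof. by rewrite /frac_part floorDrz ?floor1 ?intrD ?intr1//; ring. Qed.

Lemma measurable_frac_part : measurable_fun [set: R] frac_part.
Proof.
apply: measurable_funB; first exact: measurable_id.
apply: nondecreasing_measurable => // x y xy.
by rewrite ler_int; exact: le_floor.
Qed.

Lemma measurable_square_wave : measurable_fun [set: R] square_wave.
Proof.
apply: measurable_fun_ifT; [|exact: measurable_cst..].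
exact: measurable_fun_ltr measurable_frac_part (measurable_cst _).
Qed.

Lemma norm_square_wave x : `|square_wave x| = 1.
Proof. by rewrite /square_wave; case: ifP => _; rewrite ?normrN normr1. Qed.

Lemma norm_sgn_of_le s : `|sgn_of s| <= 1.
Proof. by case: s => [[]|] /=; rewrite ?normrN ?normr1 ?normr0. Qed.

Lemma bounded_measurable_cos_scale (c : R) : bounded_measurable (fun y => cos (c * y)).
Proof.
split; last by exists 1 => y; exact: cos_max.
apply: continuous_measurable_fun => x.
apply: (@continuous_comp _ _ _ (fun y => c * y) cos); last exact: continuous_cos.
by apply: cvgM; [exact: cvg_cst|exact: cvg_id].
Qed.

Lemma bounded_measurable_sin_scale (c : R) : bounded_measurable (fun y => sin (c * y)).
Proof.
split; last by exists 1 => y; exact: sin_max.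
apply: continuous_measurable_fun => x.
apply: (@continuous_comp _ _ _ (fun y => c * y) sin); last exact: continuous_sin.
by apply: cvgM; [exact: cvg_cst|exact: cvg_id].
Qed.

Lemma measurable_test_wave w n : measurable_fun [set: R] (test_wave w n).
Proof.
apply: measurable_funM.
  case: w.1; last exact: measurable_cst.
  by have [] := bounded_measurable_sin_scale (2 * pi * n%:R).
apply: measurable_funD; first exact: measurable_cst.
apply: measurable_funM; first exact: measurable_cst.
apply: measurableT_comp; first exact: measurable_square_wave.
exact: measurable_funM.
Qed.

Lemma test_wave_bound w n y : `|test_wave w n y| <= 2.
Proof.
rewrite normrM (_ : 2 = 1 * 2); last by rewrite mul1r.
apply: ler_pM => //; first by case: w.1; rewrite ?sin_max ?normr1.
rewrite (le_trans (ler_normD _ _))// normr1 normrM norm_square_wave mulr1.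
by have := norm_sgn_of_le w.2; lra.
Qed.

Lemma bounded_measurable_test_wave w n : bounded_measurable (test_wave w n).
Proof.
split; first exact: measurable_test_wave.
by exists 2 => x; exact: test_wave_bound.
Qed.

Lemma test_mean_bound w : `|test_mean w| <= 1.
Proof.
rewrite /test_mean; case: w.1; rewrite ?normr1// normrM.
rewrite -[leRHS]mulr1 ler_pM ?norm_sgn_of_le//.
rewrite ger0_norm ?divr_ge0 ?pi_ge0// ler_pdivrMr ?pi_gt0// mul1r.
exact: pi_ge2.
Qed.

Lemma Rintegral_sin_scale c a b : 0 < c -> a < b ->
  \int[leb]_(y in `[a, b]) sin (c * y) = (cos (c * a) - cos (c * b)) / c.
Proof.
move=> c0 ab.
have dF x : is_derive x (1 : R) (fun y => - cos (c * y) / c) (sin (c * x)).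
  apply: is_derive_eq; rewrite /GRing.scale/=.
  by field; rewrite gt_eqF.
have cF : continuous (fun y => - cos (c * y) / c).
  move=> x; apply: differentiable_continuous.
  by apply/derivable1_diffP; case: (dF x).
rewrite /Rintegral (@continuous_FTC2 _ _ (fun y => - cos (c * y) / c))//.
- by rewrite -EFinB/=; field; rewrite gt_eqF.
- apply: continuous_subspaceT => x; apply: continuous_comp.
    by apply: cvgM; [exact: cvg_cst|exact: cvg_id].
  exact: continuous_sin.
- split; first by move=> x _; case: (dF x).
  + by apply: cvg_at_right_filter; exact: cF.
  + by apply: cvg_at_left_filter; exact: cF.
- by move=> x _; rewrite derive1E; apply: derive_val.
Qed.

Lemma test_wave_half w n a b s : a < b ->
  (forall y, a <= y < b -> square_wave (n%:R * y) = s) ->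
  \int[leb]_(y in `[a, b]) test_wave w n y =
  (if w.1 then \int[leb]_(y in `[a, b]) sin (2 * pi * n%:R * y) else b - a) *
  (1 + sgn_of w.2 * s).
Proof.
move=> ab sE.
have bw := bounded_measurable_test_wave w n.
have bs : bounded_measurable (fun y => if w.1 then sin (2 * pi * n%:R * y) else 1).
  case: w.1; last exact: bounded_measurable_cst.
  exact: bounded_measurable_sin_scale.
have isub g : bounded_measurable g -> leb.-integrable `[a, b[ (EFin \o g).
  move=> bg; apply: integrableS (bounded_measurable_itv a b bg) => //.
  by apply: subset_itv; rewrite ?bnd_simp.
rewrite -Rintegral_itv_bndo_bndc; last exact: isub.
transitivity (\int[leb]_(y in `[a, b[)
   ((1 + sgn_of w.2 * s) * (if w.1 then sin (2 * pi * n%:R * y) else 1))).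
  apply: eq_Rintegral => y; rewrite inE/= in_itv/= => yab.
  by rewrite /test_wave sE// mulrC.
rewrite Rintegral_itv_bndo_bndc; last first.
  exact/isub/(bounded_measurableM (bounded_measurable_cst _)).
rewrite RintegralZ_itv// mulrC; congr (_ * _).
by case: w.1 => //; rewrite Rintegral_itv_cst ?mul1r// ltW.
Qed.

(** On each half of a period the square wave is constant, and only the
    integral of 1 or of a sine remains. *)
Lemma test_wave_block w n k : (k < n)%N ->
  \int[leb]_(y in `[k%:R / n%:R, k.+1%:R / n%:R]) test_wave w n y =
  test_mean w / n%:R.
Proof.
move=> kn; have n0 : (0 : R) < n%:R by rewrite ltr0n; exact: leq_ltn_trans kn.
set a := k%:R / n%:R; set b := k.+1%:R / n%:R.
pose m := (k%:R + 2^-1) / n%:R : R.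
have na : n%:R * a = k%:R by rewrite /a; field; rewrite gt_eqF.
have nb : n%:R * b = k.+1%:R by rewrite /b; field; rewrite gt_eqF.
have nm : n%:R * m = k%:R + 2^-1 by rewrite /m; field; rewrite gt_eqF.
have am : a < m by rewrite -(ltr_pM2l n0) na nm ltrDl invr_gt0.
have mb : m < b by rewrite -(ltr_pM2l n0) nb nm -[k.+1%:R]natr1 ltrD2l invf_lt1// ltr1n.
have ma : m - a = (2 * n%:R)^-1 by rewrite /a /m; field; rewrite gt_eqF.
have bm : b - m = (2 * n%:R)^-1.
  by rewrite /b /m -[k.+1%:R]natr1; field; rewrite gt_eqF.
have bw := bounded_measurable_test_wave w n.
rewrite (@Rintegral_itv_split _ _ _ _ m); [|exact: ltW..|exact: bounded_measurable_itv].
have hk (l : nat) : cos (2 * pi * l%:R) = 1 :> R.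
  have cl := periodicn (@cosD2pi R) l 0; rewrite add0r cos0 in cl.
  by rewrite -[RHS]cl; congr cos; rewrite -[RHS]mulr_natr -[pi *+ 2]mulr_natr; ring.
have ca : cos (2 * pi * n%:R * a) = 1 by rewrite -mulrA na hk.
have cb : cos (2 * pi * n%:R * b) = 1 by rewrite -mulrA nb hk.
have cm : cos (2 * pi * n%:R * m) = -1.
  rewrite -mulrA nm mulrDr (_ : 2 * pi * 2^-1 = pi); last by field.
  by rewrite cosDpi hk.
have c0 : 0 < 2 * pi * n%:R :> R by rewrite !mulr_gt0// pi_gt0.
rewrite (@test_wave_half _ _ _ _ 1)//; last first.
  move=> y /andP[ay ym]; rewrite /square_wave (@frac_part_itv k).
    by rewrite ifT// ltrBlDl -nm ltr_pM2l.
  by rewrite -na ler_pM2l// ay/= -nb ltr_pM2l// (lt_trans ym).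
rewrite (@test_wave_half _ _ _ _ (-1))//; last first.
  move=> y /andP[my yb]; rewrite /square_wave (@frac_part_itv k).
    by rewrite ifF//; apply/negbTE; rewrite -leNgt lerBrDl -nm ler_pM2l.
  by rewrite -na ler_pM2l// (ltW (lt_le_trans am my))/= -nb ltr_pM2l.
rewrite /test_mean; case: w.1.
  rewrite !Rintegral_sin_scale// ca cb cm.
  move: (pi_gt0 R); generalize (pi : R) => p p0.
  by field; rewrite (gt_eqF p0) (gt_eqF n0).
have -> : m - a = (2 * n%:R)^-1 by apply: ma.
have -> : b - m = (2 * n%:R)^-1 by apply: bm.
by move: n0; move: (n%:R : R) => c c1; field; rewrite gt_eqF.
Qed.

Lemma test_wave_mean w g (n : nat -> nat) : bounded_measurable g ->
  (n @ \oo --> \oo)%classic ->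
  forall e : R, 0 < e -> \forall j \near \oo,
    `|\int[leb]_(y in `[0, 1]) (g y * test_wave w (n j) y)
      - test_mean w * \int[leb]_(y in `[0, 1]) g y| <= e.
Proof.
move=> bg noo e e0.
have H := @oscillatory_mean R g (test_wave w) 2 (test_mean w) bg
  (measurable_test_wave w) (test_wave_bound w) (test_wave_block w) e e0.
exact: (noo _ H).
Qed.

(** Once the frequencies of [s] are chosen, the products of their waves with
    the [g al] form another finite family of bounded functions, so the next
    frequency only has to be large enough to average its wave against this
    family. *)
Lemma frequency_selection (V : finType) (A : finType) (g : A -> R -> R)
    (n : nat -> nat) (s : seq V) (e : R) :
  (forall al, bounded_measurable (g al)) -> (n @ \oo --> \oo)%classic ->
  uniq s -> 0 < e ->
  exists nu : V -> nat, forall al (c : {ffun V -> bool * option bool}),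
    `|\int[leb]_(y in `[0, 1]) (g al y * \prod_(u <- s) test_wave (c u) (n (nu u)) y)
      - (\prod_(u <- s) test_mean (c u)) * \int[leb]_(y in `[0, 1]) g al y| <= e.
Proof.
move=> bg noo; elim: s e => [|u0 s ih] e /=.
  move=> _ e0; exists (fun=> 0%N) => al c.
  rewrite big_nil mul1r; under eq_Rintegral do rewrite big_nil mulr1.
  by rewrite subrr normr0 ltW.
move=> /andP[u0s us] e0.
have e20 : 0 < e / 2 by rewrite divr_gt0.
have [nu hnu] := ih _ us e20.
pose g' (p : A * {ffun V -> bool * option bool}) y :=
  g p.1 y * \prod_(u <- s) test_wave (p.2 u) (n (nu u)) y.
have bg' p : bounded_measurable (g' p).
  apply: bounded_measurableM => //; apply: bounded_measurable_prod => u.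
  exact: bounded_measurable_test_wave.
have : \forall j \near \oo, forall p : A * {ffun V -> bool * option bool},
   `|\int[leb]_(y in `[0, 1]) (g' p y * test_wave (p.2 u0) (n j) y)
      - test_mean (p.2 u0) * \int[leb]_(y in `[0, 1]) g' p y| <= e / 2.
  apply: filter_forall => p; exact: test_wave_mean.
case=> j _ /(_ j (leqnn j)) hj.
exists (fun u => if u == u0 then j else nu u) => al c.
rewrite big_cons.
have -> : \int[leb]_(y in `[0, 1]) (g al y *
      \prod_(u <- u0 :: s) test_wave (c u) (n (if u == u0 then j else nu u)) y) =
   \int[leb]_(y in `[0, 1]) (g' (al, c) y * test_wave (c u0) (n j) y).
  apply: eq_Rintegral => y _; rewrite big_cons eqxx /g' /=.
  have -> : \prod_(u <- s) test_wave (c u) (n (if u == u0 then j else nu u)) y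
    = \prod_(u <- s) test_wave (c u) (n (nu u)) y.
    apply: eq_big_seq => u us'; case: eqP => // uu0.
    by rewrite -uu0 us' in u0s.
  by rewrite mulrCA mulrC.
have h1 := hj (al, c); have h2 := hnu al c; rewrite /= in h1.
rewrite -/(g' (al, c)) in h2.
set X := Rintegral _ _ _ in h1 *.
set Y := Rintegral _ _ _ in h1 h2.
set Z := Rintegral _ _ _ in h2 *.
set P := \prod_(_ <- _) _ in h2 *.
have -> : X - test_mean (c u0) * P * Z =
  (X - test_mean (c u0) * Y) + test_mean (c u0) * (Y - P * Z) by ring.
rewrite (le_trans (ler_normD _ _))// [e]splitr lerD// normrM.
by rewrite -[leRHS]mul1r ler_pM// test_mean_bound.
Qed.

End waves.

(** * Towers of cells *)

Section tower.
Variable R : realType.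

(** A finite partition of [0, 1] into intervals, the leaves of the tree of
    cells.  [carries j v] tells that leaf [v] carries mass of layer [j], and
    [side j u v] is the sign that this mass must have at the frequency of [u]:
    [Some true] if [v] is on the right of [u], [Some false] if it is on the
    left, [None] if there is no constraint.  [gain j u] is the factor 2^l,
    where l is the level at which [u] leaves the nest of block [j], and 0 if
    [u] stays in it. *)
Record tower := Tower {
  leaf :> finType;
  lo : leaf -> R;
  width : leaf -> R;
  carries : nat -> leaf -> bool;
  side : nat -> leaf -> leaf -> option bool;
  gain : nat -> leaf -> R }.

(** The supremum of the distance of two points of the leaves. *)
Definition reach (T : tower) (u v : T) : R :=
  Num.max (lo v + width v - lo u) (lo u + width u - lo v).

Section spec.
Variables (N L : nat) (kap : nat -> nat).

Definition total_gain (T : tower) (u : T) : R := \sum_(j < N) gain j u.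

(** [cnt j] factors are put on the mass of layer [j], which occupies a part
    [mass j] of the interval.  [gain_le] is the conjugate kernel seen from [u]:
    layer [j] has density 2^L where it lives and 2^(kap j) cells per level,
    hence the logarithm [kap j].  [m1] and [m2] control the first two moments
    of the sum of the gains under Lebesgue measure. *)
Record tower_spec (T : tower) (cnt : nat -> nat) (mass : nat -> R)
    (m1 m2 : R) : Prop := TowerSpec {
  width_gt0 : forall u : T, 0 < width u;
  lo_ge0 : forall u : T, 0 <= lo u;
  hi_le1 : forall u : T, lo u + width u <= 1;
  width_sum : \sum_(u : T) width u = 1;
  leaf_disjoint : forall u v : T, u != v ->
    lo u + width u <= lo v \/ lo v + width v <= lo u;
  side_sep : forall j (u v : T) b, side j u v = Some b ->
    if b then lo u + width u <= lo v else lo v + width v <= lo u;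
  carries_count : forall j (v : T), carries j v ->
    #|[pred u | side j u v != None]| = cnt j;
  carries_mass : forall j, \sum_(v : T | carries j v) width v = mass j;
  gain_le : forall j (u : T), (kap j)%:R / 2 * gain j u <=
    2 ^+ L * \sum_(v : T | carries j v && (side j u v != None)) width v / reach u v;
  moment1 : \sum_(u : T) width u * total_gain u = m1;
  moment2 : \sum_(u : T) width u * total_gain u ^+ 2 <= m2 }.

(** The blocks from [i] on have not been built yet. *)
Definition idle_from (T : tower) i := forall j (u : T), (i <= j)%N ->
  [/\ carries j u = false, forall v, side j u v = None & gain j u = 0].

(** Oresme's grouping of the harmonic series into dyadic blocks. *)
Lemma harmonic_ge n p : (2 ^ p <= n)%N ->
  1 + p%:R / 2 <= \sum_(t < n) (t.+1)%:R^-1 :> R.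
Proof.
elim: p n => [|p ih] n pn.
  case: n pn => // n _; rewrite mul0r addr0 big_ord_recl invr1 lerDl.
  by apply: sumr_ge0 => *; rewrite invr_ge0.
pose F t := (t.+1)%:R^-1 : R.
rewrite -(big_mkord xpredT F) (@big_cat_nat _ _ _ (2 ^ p.+1)%N)//=.
rewrite (@big_cat_nat _ _ _ (2 ^ p)%N _ (2 ^ p.+1)%N) ?leq_exp2l//=.
rewrite big_mkord ler_wpDr//.
  by apply: sumr_ge0 => *; rewrite invr_ge0.
have -> : 1 + p.+1%:R / 2 = (1 + p%:R / 2) + 2^-1 :> R.
  by rewrite -[p.+1%:R]natr1; field.
apply: lerD; first exact: ih.
apply: (@le_trans _ _ (\sum_(2 ^ p <= t < 2 ^ p.+1) (2 ^ p.+1)%:R^-1)).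
  rewrite sumr_const_nat expnS mul2n -addnn addnK addnn -mul2n natrM.
  rewrite -[leRHS]mulr_natr le_eqVlt; apply/orP; left; apply/eqP.
  by field; rewrite pnatr_eq0 -lt0n expn_gt0.
apply: ler_sum_nat => t /andP[_ t2].
by rewrite /F lef_pV2 ?posrE ?ltr0n ?expn_gt0// ler_nat.
Qed.

(** Up to the unit 1 / (2K), the denominators bound the distances of the points
    of the odd cell [k] to those of the even cells.  The cells on the two sides
    of [k] give two harmonic sums, of which one has at least half of the 2^p
    terms. *)
Lemma gap_sum_ge p (k : 'I_(2 ^ p)) :
  p%:R / 4 <= \sum_(k' < 2 ^ p)
    (if (k < k')%N then 2 * (k' - k)%:R else 2 * (k - k').+1%:R)^-1 :> R.
Proof.
case: p k => [k|p k].
  by rewrite mul0r; apply: sumr_ge0 => *; rewrite invr_ge0; case: ifP => _;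
    rewrite mulr_ge0.
pose F k' := (if (k < k')%N then 2 * (k' - k)%:R else 2 * (k - k').+1%:R)^-1 : R.
have F0 k' : 0 <= F k' by rewrite /F invr_ge0; case: ifP => _; rewrite mulr_ge0.
rewrite -(big_mkord xpredT F) (@big_cat_nat _ _ _ k.+1)//=.
have -> : \sum_(0 <= i < k.+1) F i = 2^-1 * \sum_(t < k.+1) (t.+1)%:R^-1.
  rewrite big_nat_rev/= big_mkord big_distrr/=; apply: eq_bigr => -[t/= tk] _.
  by rewrite /F ifF ?invfM ?add0n ?subSS; [congr (_ * _%:R^-1); lia|lia].
have -> : \sum_(k.+1 <= i < 2 ^ p.+1) F i =
    2^-1 * \sum_(t < 2 ^ p.+1 - k.+1) (t.+1)%:R^-1.
  have := big_addn 0 (2 ^ p.+1)%N k.+1 xpredT F; rewrite add0n => ->.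
  rewrite big_mkord big_distrr/=; apply: eq_bigr => -[t/= tk] _.
  by rewrite /F ifT ?invfM; [congr (_ * _%:R^-1); lia|lia].
have H0 n : 0 <= \sum_(t < n) (t.+1)%:R^-1 :> R.
  by apply: sumr_ge0 => *; rewrite invr_ge0.
have := H0 k.+1; have := H0 (2 ^ p.+1 - k.+1)%N.
have [pk|kp] := leqP (2 ^ p) k.+1.
  by have := harmonic_ge pk; rewrite -[p.+1%:R]natr1; lra.
have /harmonic_ge : (2 ^ p <= 2 ^ p.+1 - k.+1)%N.
  by have := expnS 2 p; move: (ltn_ord k); lia.
by rewrite -[p.+1%:R]natr1; lra.
Qed.

End spec.

Section combine.
Variables (K i : nat) (d : R) (T1 T0 : tower).

(** Of 2K cells the even ones are copies of [T1] and the odd ones copies of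
    [T0]: in the intended use, [T1] continues the nest of block [i] and [T0]
    contains only the finer blocks.  Whoever is in an odd cell sees the mass of
    layer [i] in all even cells, and his gain in block [i] is [d]. *)
Definition comb_leaf : finType := ('I_K * T1 + 'I_K * T0)%type.

Definition comb_lo (u : comb_leaf) : R :=
  match u with
  | inl (k, x) => ((2 * k)%:R + lo x) / (2 * K%:R)
  | inr (k, x) => ((2 * k).+1%:R + lo x) / (2 * K%:R)
  end.

Definition comb_width (u : comb_leaf) : R :=
  match u with
  | inl (_, x) => width x / (2 * K%:R)
  | inr (_, x) => width x / (2 * K%:R)
  end.

Definition comb_carries j (u : comb_leaf) : bool :=
  match u with inl (_, x) => carries j x | inr (_, x) => carries j x end.

Definition comb_side j (u v : comb_leaf) : option bool :=
  match u, v with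
  | inl (k, x), inl (k', y) => if k == k' then side j x y else None
  | inr (k, x), inr (k', y) => if k == k' then side j x y else None
  | inr (k, x), inl (k', y) =>
      if (j == i) && carries i y then Some (k < k')%N else None
  | inl _, inr _ => None
  end.

Definition comb_gain j (u : comb_leaf) : R :=
  match u with
  | inl (_, x) => gain j x
  | inr (_, x) => if j == i then d else gain j x
  end.

Definition combine : tower := Tower comb_lo comb_width comb_carries comb_side comb_gain.

Lemma big_comb (M : Type) (idx : M) (op : Monoid.com_law idx)
    (P : pred comb_leaf) (F : comb_leaf -> M) :
  \big[op/idx]_(u | P u) F u =
  op (\big[op/idx]_(k < K) \big[op/idx]_(x : T1 | P (inl (k, x))) F (inl (k, x)))
   (\big[op/idx]_(k < K) \big[op/idx]_(x : T0 | P (inr (k, x))) F (inr (k, x))).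
Proof.
rewrite big_sumType/=; congr (op _ _).
  by rewrite (pair_big_dep xpredT (fun k x => P (inl (k, x)))
    (fun k x => F (inl (k, x))))/=; apply: eq_big => -[].
by rewrite (pair_big_dep xpredT (fun k x => P (inr (k, x)))
    (fun k x => F (inr (k, x))))/=; apply: eq_big => -[].
Qed.

End combine.
End tower.

Section combine_spec.
Variable R : realType.
Variables (N L : nat) (kap : nat -> nat) (i : nat) (d : R) (T1 T0 : tower R).
Variables (cnt1 cnt0 : nat -> nat) (mass1 mass0 : nat -> R) (m11 m12 m01 m02 : R).
Hypothesis iN : (i < N)%N.
Hypothesis S1 : tower_spec N L kap T1 cnt1 mass1 m11 m12.
Hypothesis S0 : tower_spec N L kap T0 cnt0 mass0 m01 m02.
Hypothesis idle1 : idle_from T1 i.+1.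
Hypothesis idle0 : idle_from T0 i.
Hypothesis d_ge0 : 0 <= d.
Hypothesis mass_d : 2 ^+ L * mass1 i = 2 * d.
Hypothesis cnt10 : forall j, (j < i)%N -> cnt1 j = cnt0 j.

Local Notation K := (2 ^ kap i)%N.
Local Notation T := (combine K i d T1 T0).
Local Notation K2 := (2 * K%:R : R).

Let K0 : (0 : R) < K%:R. Proof. by rewrite ltr0n expn_gt0. Qed.
Let K20 : 0 < K2. Proof. by rewrite mulr_gt0. Qed.

Let cell_le (a b : nat) (x y : R) :
  0 <= y -> x <= 1 -> (a < b)%N -> (a%:R + x) / K2 <= (b%:R + y) / K2.
Proof.
move=> y0 x1 ab; rewrite ler_pM2r ?invr_gt0//.
by move: ab; rewrite -(ler_nat R) -natr1; lra.
Qed.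

Let copy_lo (a : R) (x w : R) : (a + x) / K2 + w / K2 = (a + (x + w)) / K2.
Proof. by rewrite -mulrDl addrA. Qed.

Let copy_le (a x y : R) : ((a + x) / K2 <= (a + y) / K2) = (x <= y).
Proof. by rewrite ler_pM2r ?invr_gt0// lerD2l. Qed.

Let comb_width_gt0 (u : T) : 0 < width u.
Proof.
by case: u => -[k x]/=; rewrite divr_gt0//; [exact: width_gt0 S1 _|exact: width_gt0 S0 _].
Qed.

Let comb_lo_ge0 (u : T) : 0 <= lo u.
Proof.
by case: u => -[k x]/=; apply: divr_ge0 (ltW K20); apply: addr_ge0 => //;
  [exact: lo_ge0 S1 _|exact: lo_ge0 S0 _].
Qed.

Let KK2 : ((2 * K)%:R + 0) / K2 = 1.
Proof. by rewrite natrM addr0 divff// gt_eqF. Qed.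

Let comb_hi_le1 (u : T) : lo u + width u <= 1.
Proof.
case: u => -[k x]; rewrite /= copy_lo -[leRHS]KK2; apply: cell_le => //.
- exact: hi_le1 S1 _.
- by have := ltn_ord k; lia.
- exact: hi_le1 S0 _.
- by have := ltn_ord k; lia.
Qed.

Let comb_avg (F1 : T1 -> R) (F0 : T0 -> R) (F : T -> R) :
  (forall k x, F (inl (k, x)) = F1 x / K2) ->
  (forall k x, F (inr (k, x)) = F0 x / K2) ->
  \sum_(u : T) F u = (\sum_x F1 x + \sum_x F0 x) / 2.
Proof.
move=> hF1 hF0; rewrite big_comb.
have -> : \sum_(k < K) \sum_x F (inl (k, x)) = \sum_(k < K) \sum_x F1 x / K2.
  by apply: eq_bigr => k _; apply: eq_bigr.
have -> : \sum_(k < K) \sum_x F (inr (k, x)) = \sum_(k < K) \sum_x F0 x / K2.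
  by apply: eq_bigr => k _; apply: eq_bigr.
have E s : (s *+ K) / K2 = s / 2.
  by rewrite -mulr_natl; move: K0; move: (K%:R : R) => c c0; field; rewrite gt_eqF.
by rewrite -!mulr_suml !sumr_const !card_ord /= !E -mulrDl.
Qed.

Let comb_width_sum : \sum_(u : T) width u = 1.
Proof.
rewrite (@comb_avg (@width R T1) (@width R T0))// (width_sum S1) (width_sum S0).
by field.
Qed.

Let comb_disjoint (u v : T) : u != v ->
    lo u + width u <= lo v \/ lo v + width v <= lo u.
Proof.
have h1 := hi_le1 S1; have h0 := hi_le1 S0.
have l1 := lo_ge0 S1; have l0 := lo_ge0 S0.
case: u v => -[k x] [] [l y] uv; rewrite /= !copy_lo.
- have [kl|lk|kl] := ltngtP (k : nat) l.
  + by left; apply: cell_le => //; lia.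
  + by right; apply: cell_le => //; lia.
  + have {}kl : k = l by exact: val_inj.
    rewrite -kl !copy_le; apply: (leaf_disjoint S1).
    by apply: contra_neq uv => ->; rewrite kl.
- have [kl|lk] := leqP k l.
  + by left; apply: cell_le => //; lia.
  + by right; apply: cell_le => //; lia.
- have [kl|lk] := leqP l k.
  + by right; apply: cell_le => //; lia.
  + by left; apply: cell_le => //; lia.
- have [kl|lk|kl] := ltngtP (k : nat) l.
  + by left; apply: cell_le => //; lia.
  + by right; apply: cell_le => //; lia.
  + have {}kl : k = l by exact: val_inj.
    rewrite -kl !copy_le; apply: (leaf_disjoint S0).
    by apply: contra_neq uv => ->; rewrite kl.
Qed.

Let comb_sep j (u v : T) b : side j u v = Some b ->
    if b then lo u + width u <= lo v else lo v + width v <= lo u.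
Proof.
have h1 := hi_le1 S1; have h0 := hi_le1 S0.
have l1 := lo_ge0 S1; have l0 := lo_ge0 S0.
case: u v => -[k x] [] [l y] //=; rewrite ?copy_lo.
- by case: eqP => // -> /(side_sep S1); case: b; rewrite copy_le.
- case: ifP => // _ [<-]; case: ltnP => kl; apply: cell_le => //; lia.
- by case: eqP => // -> /(side_sep S0); case: b; rewrite copy_le.
Qed.

Let cnt j := if j == i then (cnt1 i + K * #|T0|)%N else cnt0 j.

Let comb_count j (v : T) : carries j v ->
  #|[pred u | side j u v != None]| = cnt j.
Proof.
have [ij|ji] := ltnP i j.
  case: v => -[k y] /=; first by case: (idle1 y ij) => ->.
  by case: (idle0 y (ltnW ij)) => ->.
have cE (F : pred T) : #|F| = (\sum_(k < K) #|[pred x : T1 | F (inl (k, x))]| +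
    \sum_(k < K) #|[pred x : T0 | F (inr (k, x))]|)%N.
  rewrite -sum1_card big_comb/=; congr (_ + _)%N;
    by apply: eq_bigr => k _; rewrite -sum1_card.
have one (T' : tower R) (l : 'I_K) (y : T') :
    (\sum_(k < K) #|[pred x : T' | (if k == l then side j x y else None) != None]|
    = #|[pred x | side j x y != None]|)%N.
  rewrite (bigD1 l)//= big1 ?addn0.
    by apply: eq_card => x; rewrite !inE eqxx.
  by move=> k /negbTE kl; apply: eq_card0 => x; rewrite !inE kl.
have zero (T' : tower R) :
    (\sum_(k < K) #|[pred x : T' | None != None :> option bool]| = 0)%N.
  by rewrite big1// => k _; apply: eq_card0 => x; rewrite !inE.
rewrite cE; case: v => -[l y] /= carv; rewrite ?one ?zero.
- rewrite /cnt; have [ji'|ji'] := eqVneq j i => /=.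
    subst j; rewrite (carries_count S1)//; congr (_ + _)%N.
    rewrite (eq_bigr (fun=> #|T0|)) ?sum_nat_const ?card_ord// => k _.
    by apply: eq_card => x; rewrite !inE carv.
  by rewrite zero addn0 (carries_count S1)// cnt10// ltn_neqAle ji'.
- rewrite add0n /cnt; have [ji'|ji'] := eqVneq j i.
    by subst j; case: (idle0 y (leqnn i)) carv => ->.
  by rewrite (carries_count S0).
Qed.

Let comb_mass j : \sum_(v : T | carries j v) width v = (mass1 j + mass0 j) / 2.
Proof.
rewrite big_mkcond (@comb_avg (fun x => if carries j x then width x else 0)
  (fun x => if carries j x then width x else 0)) -?big_mkcond.
- by rewrite (carries_mass S1) (carries_mass S0).
- by move=> k x /=; case: ifP; rewrite ?mul0r.
- by move=> k x /=; case: ifP; rewrite ?mul0r.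
Qed.

Let gainE (u : T) : total_gain N u =
  match u with inl (_, x) => total_gain N x | inr (_, x) => d + total_gain N x end.
Proof.
case: u => -[k x]; rewrite /total_gain//=.
rewrite (bigD1 (Ordinal iN))//= eqxx [in RHS](bigD1 (Ordinal iN))//=.
have [_ _ ->] := idle0 x (leqnn i); rewrite add0r; congr (_ + _).
by apply: eq_bigr => j; rewrite -(inj_eq val_inj)/= => /negbTE ->.
Qed.

Let comb_moment1 :
  \sum_(u : T) width u * total_gain N u = (m11 + (m01 + d)) / 2.
Proof.
rewrite (@comb_avg (fun x => width x * total_gain N x)
  (fun x => width x * (d + total_gain N x))); last 2 first.
- by move=> k x; rewrite gainE /= mulrAC.
- by move=> k x; rewrite gainE /= mulrAC.
rewrite (moment1 S1); under [X in _ + X]eq_bigr do rewrite mulrDr.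
by rewrite big_split/= (moment1 S0) -mulr_suml (width_sum S0) mul1r (addrC d).
Qed.

Let comb_moment2 : \sum_(u : T) width u * total_gain N u ^+ 2 <=
  (m12 + (m02 + 2 * d * m01 + d ^+ 2)) / 2.
Proof.
rewrite (@comb_avg (fun x => width x * total_gain N x ^+ 2)
  (fun x => width x * (d + total_gain N x) ^+ 2)); last 2 first.
- by move=> k x; rewrite gainE /= mulrAC.
- by move=> k x; rewrite gainE /= mulrAC.
rewrite ler_pM2r ?invr_gt0// lerD ?(moment2 S1)//.
have -> : \sum_(x : T0) width x * (d + total_gain N x) ^+ 2 =
   \sum_(x : T0) (width x * total_gain N x ^+ 2 + 2 * d * (width x * total_gain N x)
     + width x * d ^+ 2) by apply: eq_bigr => x _; ring.
rewrite !big_split/= -mulr_sumr (moment1 S0) -mulr_suml (width_sum S0) mul1r.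
by rewrite !lerD2r (moment2 S0).
Qed.

Let reach_copy (a xl xw yl yw : R) :
  Num.max ((a + yl) / K2 + yw / K2 - (a + xl) / K2)
          ((a + xl) / K2 + xw / K2 - (a + yl) / K2) =
  Num.max (yl + yw - xl) (xl + xw - yl) / K2.
Proof.
rewrite maxr_pMl ?invr_ge0 ?(ltW K20)//.
by congr Num.max; rewrite -mulrDl -mulrBl; congr (_ / _); ring.
Qed.

Let comb_reach_gt0 (u v : T) : 0 < reach u v.
Proof.
have := comb_width_gt0 u; have := comb_width_gt0 v; rewrite /reach lt_max.
by have [|] := lerP (lo u) (lo v); move=> *; apply/orP; [left|right]; lra.
Qed.

Let term_ge0 (u v : T) : 0 <= width v / reach u v.
Proof. by rewrite divr_ge0// ltW. Qed.

Let comb_gain_le j (u : T) : (kap j)%:R / 2 * gain j u <=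
    2 ^+ L * \sum_(v : T | carries j v && (side j u v != None)) width v / reach u v.
Proof.
have L0 : 0 < 2 ^+ L :> R by rewrite exprn_gt0.
have quot (a b : R) : (a / K2) / (b / K2) = a / b.
  by rewrite invf_div mulrA divfK// gt_eqF.
rewrite big_comb; case: u => -[k x].
- apply: (le_trans (gain_le S1 j x)); rewrite ler_pM2l//.
  rewrite ler_wpDr//; first by apply: sumr_ge0 => a _; apply: sumr_ge0 => b _;
    exact: term_ge0.
  rewrite (bigD1 k)//= ler_wpDr//; first by apply: sumr_ge0 => a _; apply: sumr_ge0 => b _;
    exact: (term_ge0 (inl (k, x)) (inl (a, b))).
  rewrite le_eqVlt; apply/orP; left; apply/eqP.
  apply: eq_big => [y|y _]; first by rewrite eqxx.
  by rewrite /reach/= reach_copy quot.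
- have [ji|ji] := eqVneq j i; last first.
    rewrite /= (negbTE ji); apply: (le_trans (gain_le S0 j x)); rewrite ler_pM2l//.
    rewrite ler_wpDl//; first by apply: sumr_ge0 => a _; apply: sumr_ge0 => b _;
    exact: (term_ge0 (inr (k, x)) (inl (a, b))).
    rewrite (bigD1 k)//= ler_wpDr//; first by apply: sumr_ge0 => a _; apply: sumr_ge0 => b _;
    exact: (term_ge0 (inr (k, x)) (inr (a, b))).
    rewrite le_eqVlt; apply/orP; left; apply/eqP.
    apply: eq_big => [y|y _]; first by rewrite eqxx.
    by rewrite /reach/= reach_copy quot.
  subst j; rewrite /= eqxx.
  pose gap k' := if (k < k')%N then 2 * (k' - k)%:R else 2 * (k - k').+1%:R : R.
  have gap0 k' : 0 < gap k'.
    by rewrite /gap; case: ltnP => ?; rewrite mulr_gt0// ltr0n// subn_gt0.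
  apply: (@le_trans _ _ (2 ^+ L * \sum_(k' < K) mass1 i / gap k')).
    rewrite -mulr_sumr mulrA mass_d.
    have := ler_wpM2l d_ge0 (gap_sum_ge R k); rewrite -/gap.
    by set S := \sum_(_ < _) _; lra.
  rewrite ler_pM2l// ler_wpDr//; first by apply: sumr_ge0 => a _; apply: sumr_ge0 => b _;
    exact: (term_ge0 (inr (k, x)) (inr (a, b))).
  apply: ler_sum => k' _; rewrite -(carries_mass S1) mulr_suml.
  rewrite [leRHS](eq_bigl (fun y => carries i y)); last first.
    by move=> y /=; case: (carries i y).
  apply: ler_sum => y cy.
  rewrite -[leRHS]mulrA -invfM.
  rewrite ler_pM2l ?(width_gt0 S1)// lef_pV2 ?posrE ?mulr_gt0//.
  have lx := lo_ge0 S0 x; have ly := lo_ge0 S1 y.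
  have hx := hi_le1 S0 x; have hy := hi_le1 S1 y.
  have wx := width_gt0 S0 x; have wy := width_gt0 S1 y.
  rewrite mulrC -ler_pdivlMr// /reach ge_max /= -!mulrDl -!mulNr -!mulrDl.
  rewrite !ler_pM2r ?invr_gt0//.
  rewrite /gap; case: ltnP => kk; apply/andP; split.
  + by rewrite natrB ?(ltnW kk)// -natr1 !natrM; lra.
  + have : k.+1%:R <= k'%:R :> R by rewrite ler_nat.
    by rewrite natrB ?(ltnW kk)// -!natr1 !natrM; lra.
  + have : k'%:R <= k%:R :> R by rewrite ler_nat.
    by rewrite -!natr1 natrB// !natrM; lra.
  + by rewrite -!natr1 natrB// !natrM; lra.
Qed.

(** The hypothesis [mass_d] says that the mass of layer [i] has density 2 d in
    the even cells, hence d on the average. *)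
Lemma combine_spec :
  tower_spec N L kap T cnt (fun j => (mass1 j + mass0 j) / 2)
   ((m11 + (m01 + d)) / 2) ((m12 + (m02 + 2 * d * m01 + d ^+ 2)) / 2).
Proof. by split. Qed.

Lemma combine_idle : idle_from T i.+1.
Proof.
move=> j [] [k x] ij.
- have [c s g] := idle1 x ij; split => //.
  by move=> [] [l y] //=; case: eqP => // _; rewrite s.
- have [c s g] := idle0 x (ltnW ij); split => //=; last by rewrite gtn_eqF.
  move=> [] [l y] //=; first by rewrite gtn_eqF.
  by case: eqP => // _; rewrite s.
Qed.

Lemma card_combine : #|T| = (K * (#|T1| + #|T0|))%N.
Proof. by rewrite card_sum !card_prod card_ord -mulnDr. Qed.

End combine_spec.

Section tower_exists.
Variable R : realType.

Definition point_tower : tower R :=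
  @Tower R unit (fun=> 0) (fun=> 1) (fun _ _ => false) (fun _ _ _ => None)
    (fun _ _ => 0).

(** The innermost cells of the nest of block [i] carry the mass of layer [i]. *)
Definition mark (i : nat) (T : tower R) : tower R :=
  @Tower R T (@lo R T) (@width R T) (fun j u => (j == i) || carries j u) (@side R T)
    (@gain R T).

Lemma tower_spec_eq N L kap (T : tower R) cnt cnt' mass mass' m1 m1' m2 m2' :
  tower_spec N L kap T cnt mass m1 m2 -> cnt =1 cnt' -> mass =1 mass' ->
  m1 = m1' -> m2 <= m2' -> tower_spec N L kap T cnt' mass' m1' m2'.
Proof.
move=> [] h1 h2 h3 h4 h5 h6 h7 h8 h9 h10 h11 ec em e1 e2; split => //.
- by move=> j v /h7 ->.
- by move=> j; rewrite h8.
- by rewrite h10.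
- exact: le_trans e2.
Qed.

Section block.
Variables (N L : nat) (kap : nat -> nat) (i : nat) (T0 : tower R).
Variables (cnt0 : nat -> nat) (mass0 : nat -> R) (m01 m02 : R).
Hypothesis iN : (i < N)%N.
Hypothesis S0 : tower_spec N L kap T0 cnt0 mass0 m01 m02.
Hypothesis idle0 : idle_from T0 i.

Local Notation K := (2 ^ kap i)%N.

Lemma mark_spec : tower_spec N L kap (mark i T0)
  (fun j => if j == i then 0%N else cnt0 j)
  (fun j => if j == i then 1 else mass0 j) m01 m02.
Proof.
split; try by case: S0.
- move=> j v /=; have [->|ji] := eqVneq j i => /= cv; last by rewrite (carries_count S0).
  by apply: eq_card0 => u; rewrite !inE; have [_ -> _] := idle0 u (leqnn i).
- move=> j /=; have [->|ji] := eqVneq j i => /=; first exact: (width_sum S0).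
  by rewrite (carries_mass S0).
- move=> j u /=; have [->|ji] := eqVneq j i => /=; last exact: (gain_le S0).
  have [_ s ->] := idle0 u (leqnn i).
  by rewrite mulr0 big1 ?mulr0// => v; rewrite s.
Qed.

Lemma mark_idle : idle_from (mark i T0) i.+1.
Proof.
by move=> j u ij; have [c s g] := idle0 u (ltnW ij); split => //=;
   rewrite c gtn_eqF.
Qed.

(** The nest of block [i] is built from the inside.  When [e] levels exist,
    the outer cell has level L - e, and x = 2^(L - e) is both the mean density
    of the layer in it and the gain of the level built last. *)
Lemma block_exists e : (e <= L)%N -> exists T1 : tower R,
  let x := 2 ^+ L / 2 ^+ e in
  [/\ tower_spec N L kap T1
        (fun j => if j == i then (e * K * #|T0|)%N else cnt0 j)
        (fun j => if j == i then (2 ^+ e)^-1 else mass0 j)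
        (m01 + x * e%:R / 2)
        (m02 + m01 * x * e%:R + x * (2 ^+ L - x) / 2),
      idle_from T1 i.+1 & (#|T1| <= (2 * K) ^ e * #|T0|)%N].
Proof.
elim: e => [_|e ih eL].
  exists (mark i T0); split; last 2 first.
    exact: mark_idle.
    by rewrite expn0 mul1n.
  apply: (tower_spec_eq mark_spec) => //.
  - by move=> j; case: ifP => //; rewrite invr1.
  - by rewrite mulr0 mul0r addr0.
  - by rewrite mulr0 addr0 invr1 mulr1 subrr mulr0 mul0r addr0.
have [T1 [S1 idle1 q1]] := ih (ltnW eL).
pose d : R := 2 ^+ L / 2 ^+ e.+1.
have d0 : 0 <= d by rewrite divr_ge0 ?exprn_ge0.
have e0 : 2 ^+ e != 0 :> R by rewrite expf_neq0.
exists (combine K i d T1 T0); split.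
- apply: (tower_spec_eq (combine_spec iN S1 S0 idle1 idle0 d0 _ _)).
  + by rewrite eqxx /d exprS; field.
  + by move=> j /ltn_eqF ->.
  + by move=> j; rewrite eqxx; case: ifP => // _; lia.
  + move=> j; have [->|ji] := eqVneq j i.
      have <- := carries_mass S0 i.
      rewrite big1 ?addr0 => [|u]; first by rewrite exprS; field.
      by have [-> _ _] := idle0 u (leqnn i).
    by field.
  + by rewrite /d exprS -[e.+1%:R]natr1; field.
  + rewrite le_eqVlt; apply/orP; left; apply/eqP.
    by rewrite /d exprS -[e.+1%:R]natr1; field.
- exact: combine_idle.
- rewrite card_combine expnS.
  apply: (@leq_trans (K * (2 * ((2 * K) ^ e * #|T0|)))%N); last by lia.
  rewrite leq_mul2l; apply/orP; right; rewrite mul2n -addnn leq_add//.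
  by rewrite leq_pmull// expn_gt0 muln_gt0 expn_gt0.
Qed.

End block.

(** A cell of block [i] is divided into twice 2^([kappa L i]) cells.  The ratio
    2^(L + 2) of these exponents makes the tower of the blocks below [i] have
    at most 2^([kappa L i]) leaves. *)
Definition kappa L i := (2 ^ ((L + 2) * i.+1))%N.

Lemma kappaS L i : kappa L i.+1 = (2 ^ (L + 2) * kappa L i)%N.
Proof. by rewrite /kappa -expnD; congr (_ ^ _)%N; lia. Qed.

Lemma kappa_ge L i : (2 ^ (L + 2) <= kappa L i)%N.
Proof. by rewrite leq_exp2l// leq_pmulr. Qed.

Lemma ltn_2expn n : (n < 2 ^ n)%N. Proof. exact: ltn_expl. Qed.

(** Under Lebesgue measure the gains of the blocks are independent; the gain
    of a block has mean L / 2 and second moment at most 2^L, because the gain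
    2^l occurs with probability 2^-(l+1). *)
Lemma tower_exists N L i : (0 < L)%N -> (i <= N)%N ->
  exists (T : tower R) (cnt : nat -> nat),
  [/\ tower_spec N L (kappa L) T cnt
        (fun j => if (j < i)%N then (2 ^+ L)^-1 else 0) (i%:R * L%:R / 2)
        (i%:R * 2 ^+ L + (i%:R * L%:R / 2) ^+ 2),
      idle_from T i,
      (0 < #|T| <= 2 ^ kappa L i)%N &
      forall j, (j < i)%N -> (2 ^ kappa L j <= cnt j <= 2 ^ (L + 2 * kappa L j))%N].
Proof.
move=> L0; elim: i => [_|i ih iN].
  exists point_tower, (fun=> 0%N); split => //; last by rewrite card_unit expn_gt0.
  split => //=.
  - rewrite (eq_bigl (pred1 tt)) ?big_pred1_eq//; by case.
  - by move=> j; rewrite big_pred0.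
  - by move=> j u; rewrite mulr0 big_pred0 ?mulr0.
  - by rewrite big1 ?mul0r// => u _; rewrite /total_gain big1 ?mulr0.
  - rewrite big1 ?mul0r ?expr0n ?addr0// => u _.
    by rewrite /total_gain big1// expr0n mulr0.
have [T0 [cnt0 [S0 idle0 /andP[q0 q1] hcnt0]]] := ih (ltnW iN).
have [T1 [S1 idle1 qT1]] := block_exists iN S0 idle0 (leqnn L).
exists T1, (fun j => if j == i then (L * 2 ^ kappa L i * #|T0|)%N else cnt0 j).
split.
- apply: (tower_spec_eq S1) => //.
  + move=> j /=; have [->|ji] := eqVneq j i; first by rewrite ltnSn.
    by rewrite [in RHS]ltnS [in RHS]leq_eqVlt (negbTE ji).
  + by rewrite divff ?expf_neq0// -[i.+1%:R]natr1; field.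
  + rewrite divff ?expf_neq0// -[i.+1%:R]natr1.
    have : 0 <= 2 ^+ L :> R by rewrite exprn_ge0.
    have : 0 <= (L%:R : R) ^+ 2 by rewrite sqr_ge0.
    by lra.
- exact: idle1.
- apply/andP; split.
    case: (posnP #|T1|) => // /card0_eq T10.
    have := width_sum S1; rewrite big1 => [/eqP|u _]; last by have := T10 u.
    by rewrite eq_sym oner_eq0.
  apply: (leq_trans qT1); rewrite -expnS -expnM.
  apply: (@leq_trans (2 ^ ((kappa L i).+1 * L) * 2 ^ kappa L i)%N).
    by rewrite leq_mul2l q1 orbT.
  rewrite -expnD leq_exp2l// kappaS expnD.
  have := ltn_2expn L; have := kappa_ge L i; have := expn_gt0 2 (L + 2).
  set k := kappa L i; set a := (2 ^ L)%N => /= h1 h2 h3; nia.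
- move=> j; rewrite ltnS leq_eqVlt; have [->|ji] := eqVneq j i => /=; last exact: hcnt0.
  move=> _; apply/andP; split.
    by rewrite mulnAC leq_pmull// muln_gt0 L0.
  rewrite -mulnA mulnC mul2n -addnn !expnD mulnC leq_mul//.
    exact/ltnW/ltn_2expn.
  by rewrite leq_mul2l q1 orbT.
Qed.

End tower_exists.

(** * The kernel *)

Section kernel.
Variable R : realType.
Implicit Types (x y t d : R).

Lemma sin_le_id x : 0 <= x -> sin x <= x.
Proof.
rewrite le_eqVlt => /predU1P[<-|x0]; first by rewrite sin0.
have cs : {within `[0, x], continuous (@sin R)}.
  by apply: continuous_subspaceT => ?; exact: continuous_sin.
have [c _] := MVT x0 (fun z _ => is_derive_sin z) cs.
rewrite sin0 !subr0 => ->.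
by rewrite ler_piMl ?cos_le1// ltW.
Qed.

(** cos (pi / 4) = 1 / sqrt 2 by the double angle formula, and 1/2 is
    enough. *)
Lemma cos_quarter_ge x : 0 <= x <= 4^-1 -> 2^-1 <= cos (pi * x).
Proof.
move=> /andP[x0 x1]; have p0 := pi_gt0 R.
have qle : cos (pi * 4^-1) <= cos (pi * x).
  have [/eqP ->//|xq] := boolP (x == 4^-1).
  apply/ltW; rewrite ltr_cos.
  - by rewrite ltr_pM2l// lt_neqAle xq.
  - rewrite in_itv/=; apply/andP; split; first by rewrite mulr_ge0// ltW.
    by rewrite ler_piMr ?(ltW p0)//; lra.
  - rewrite in_itv/=; apply/andP; split; first by rewrite mulr_ge0// ltW.
    by rewrite ler_piMr ?(ltW p0)//; lra.
apply: le_trans qle; set c := cos _.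
have c0 : 0 <= c by apply: cos_ge0_pihalf; apply/andP; split; lra.
have : c ^+ 2 *+ 2 = 1.
  have := cos_mulr2n (pi * 4^-1 : R); rewrite -/c.
  rewrite (_ : (pi * 4^-1) *+ 2 = pi / 2); last by rewrite -mulr_natr; field.
  by rewrite cos_pihalf => /esym/eqP; rewrite subr_eq0 => /eqP.
by rewrite -mulr_natr; nra.
Qed.

Lemma cot_ge t : 0 < t <= 4^-1 -> (8 * t)^-1 <= cot (pi * t).
Proof.
move=> /andP[t0 t1]; have p0 := pi_gt0 R.
have p4 : pi < 4 :> R by have := pihalf_lt2 R; lra.
have s0 : 0 < sin (pi * t).
  apply: sin_gt0_pi; rewrite mulr_gt0//=.
  by rewrite -[ltRHS]mulr1 ltr_pM2l//; lra.
rewrite /cot ler_pdivlMr// mulrC ler_pdivrMr; last by rewrite mulr_gt0.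
apply: (le_trans (sin_le_id _)); first by rewrite mulr_ge0 ?ltW.
have := @cos_quarter_ge t; rewrite (ltW t0) t1 => /(_ isT); nra.
Qed.

Lemma cotN x : cot (- x) = - cot x :> R.
Proof. by rewrite /cot cosN sinN invrN mulrN. Qed.

(** A continuous bounded kernel which agrees with cot (pi t) at distance at
    least d from its pole. *)
Definition cut_cot d t : R :=
  cos (pi * t) * sin (pi * t) / Num.max (sin (pi * t) ^+ 2) (sin (pi * d) ^+ 2).

Section cut.
Variable d : R.
Hypothesis d01 : 0 < d <= 4^-1.

Let sd0 : 0 < sin (pi * d).
Proof.
move: d01 => /andP[d0 d1]; have p0 := pi_gt0 R.
apply: sin_gt0_pi; rewrite mulr_gt0//=.
by rewrite -[ltRHS]mulr1 ltr_pM2l//; lra.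
Qed.

Let den0 t : 0 < Num.max (sin (pi * t) ^+ 2) (sin (pi * d) ^+ 2).
Proof. by rewrite lt_max [X in _ || X]exprn_gt0 ?orbT. Qed.

Lemma continuous_cut_cot : continuous (cut_cot d).
Proof.
have cp : continuous (fun t => pi * t : R).
  by move=> t; apply: cvgM; [exact: cvg_cst|exact: cvg_id].
have csin : continuous (fun t => sin (pi * t) : R).
  by move=> t; apply: continuous_comp; [exact: cp|exact: continuous_sin].
have ccos : continuous (fun t => cos (pi * t) : R).
  by move=> t; apply: continuous_comp; [exact: cp|exact: continuous_cos].
move=> t; apply: cvgM; first by apply: cvgM; [exact: ccos|exact: csin].
apply: cvgV; first by rewrite gt_eqF.
apply: (@continuous_max _ _ (fun t => sin (pi * t) ^+ 2) (cst (sin (pi * d) ^+ 2))).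
  apply: (@continuous_comp _ _ _ (fun t => sin (pi * t)) (fun s => s ^+ 2)).
    exact: csin.
  exact: exprn_continuous.
exact: cvg_cst.
Qed.

Lemma bounded_measurable_cut_cot x : bounded_measurable (fun y => cut_cot d (x - y)).
Proof.
split.
  apply: continuous_measurable_fun => y.
  apply: (@continuous_comp _ _ _ (fun y => x - y) (cut_cot d)).
    by apply: cvgB; [exact: cvg_cst|exact: cvg_id].
  exact: continuous_cut_cot.
exists ((sin (pi * d) ^+ 2)^-1) => y.
rewrite !normrM normfV [X in _ / X]gtr0_norm// -[leRHS]mul1r ler_pM//.
- by rewrite invr_ge0 ltW.
- by rewrite mulr_ile1 ?cos_max ?sin_max.
- by rewrite lef_pV2 ?posrE ?exprn_gt0// le_max lexx orbT.
Qed.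

Lemma cut_cotE t : d <= `|t| <= 4^-1 -> cut_cot d t = cot (pi * t).
Proof.
move: d01 => /andP[d0 d1]; have p0 := pi_gt0 R.
have pos s : d <= s <= 4^-1 -> sin (pi * d) <= sin (pi * s).
  move=> /andP[ds s1]; have [/eqP ->//|sd] := boolP (d == s).
  apply/ltW; rewrite ltr_sin.
  - by rewrite ltr_pM2l// lt_neqAle sd.
  - by rewrite in_itv/=; apply/andP; split; nra.
  - by rewrite in_itv/=; apply/andP; split; nra.
move=> dt; rewrite /cut_cot /cot max_l.
  have : sin (pi * t) != 0.
    have [t0|t0] := leP 0 t.
      rewrite ger0_norm// in dt; rewrite gt_eqF//.
      exact: lt_le_trans (pos _ dt).
    rewrite ltr0_norm// in dt; rewrite -oppr_eq0 -sinN -mulrN gt_eqF//.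
    exact: lt_le_trans (pos _ dt).
  by move=> s0; field.
have [t0|t0] := leP 0 t.
  rewrite ger0_norm// in dt; have st := pos _ dt.
  by rewrite ler_sqr ?nnegrE// ltW// (lt_le_trans sd0).
rewrite ltr0_norm// in dt; have st := pos _ dt.
rewrite -[X in _ <= X]sqrrN -sinN -mulrN.
by apply: (lerXn2r 2%N) => //; rewrite nnegrE ltW// (lt_le_trans sd0).
Qed.

End cut.
End kernel.

(** * Lower bound for the lacunary Carleson operator *)

Section operator.
Variable R : realType.
Implicit Types (x y t d : R) (f g : R -> R).
Local Notation leb := (@lebesgue_measure R).

(** If the integrand vanishes near the singularity, the truncated integrals do
    not depend on the truncation any more. *)
Lemma pv_integral_away x g e0 : 0 < e0 ->
  (forall y, 0 <= y <= 1 -> g y != 0 -> forall m : int, e0 <= `|x - y - m%:~R|) ->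
  pv_integral x g = \int[leb]_(y in `[0, 1]) g y.
Proof.
move=> e00 away; rewrite /pv_integral; apply: lim_near_cst => //; near=> e.
rewrite Rintegral_mkcond [RHS]Rintegral_mkcond.
apply: eq_Rintegral => y _; rewrite !patchE.
have [y01|y01] := boolP (y \in `[0, 1]%classic); last first.
  rewrite memNset// => -[y01' _]; move: y01.
  by rewrite notin_setE/= in_itv/= y01'.
rewrite inE/= in_itv/= in y01.
have [gy0|gy0] := eqVneq (g y) 0; first by rewrite gy0; case: ifP.
rewrite mem_set//; split=> // m; apply: lt_le_trans (away _ y01 gy0 m).
by near: e; exact: nbhs_right_lt.
Unshelve. all: by end_near. Qed.

Lemma int_dist_ge d (t : R) (m : int) : 0 < d <= 4^-1 -> d <= `|t| <= 4^-1 ->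
  d <= `|t - m%:~R|.
Proof.
move=> /andP[d0 d1] /andP[dt t1].
have [->|m0] := eqVneq m 0; first by rewrite subr0.
have m1 : 1 <= `|m%:~R : R|.
  by rewrite -intr_norm -[1]/(1%:~R) ler_int -gtz0_ge1 normr_gt0.
have := lerB_dist (m%:~R) t; rewrite distrC; lra.
Qed.

(** The addition formulas factor the phase of x out of the modulus, so that
    the sine integral alone is a lower bound. *)
Lemma lac_carleson_ge (n : nat -> nat) f x d j : 0 < d <= 4^-1 ->
  bounded_measurable f ->
  (forall y, 0 <= y <= 1 -> f y != 0 -> d <= `|x - y| <= 4^-1) ->
  (`|\int[leb]_(y in `[0, 1])
      (sin (2 * pi * (n j)%:R * y) * (cut_cot d (x - y) * f y))|%:E
   <= lac_carleson n f x)%E.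
Proof.
move=> d01 bf away; apply: le_ereal_sup_tmp.
exists (ComplexField.Normc.normc
      (pv_cintegral x (fun y =>
         cexpi (2 * pi * (n j)%:R * (x - y))
         * (cot (pi * (x - y)))%:C%C * (f y)%:C%C)))%:E; first by exists j.
rewrite lee_fin; have /andP[d0 _] := d01.
pose k y := cut_cot d (x - y) * f y.
have bk : bounded_measurable k.
  by apply: bounded_measurableM => //; exact: bounded_measurable_cut_cot.
pose th := 2 * pi * (n j)%:R : R.
pose a := \int[leb]_(y in `[0, 1]) (cos (th * y) * k y).
pose b := \int[leb]_(y in `[0, 1]) (sin (th * y) * k y).
have bcos := bounded_measurableM (bounded_measurable_cos_scale th) bk.
have bsin := bounded_measurableM (bounded_measurable_sin_scale th) bk.
have lin (al be : R) g :
   (forall y, 0 <= y <= 1 -> g y = al * (cos (th * y) * k y) + be * (sin (th * y) * k y)) ->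
   (forall y, 0 <= y <= 1 -> f y = 0 -> g y = 0) ->
   pv_integral x g = al * a + be * b.
  move=> gE g0; rewrite (@pv_integral_away _ _ d)//; last first.
    move=> y y01 gy m; apply: int_dist_ge => //; apply: away => //.
    by apply: contra_neq gy; exact: g0.
  rewrite /a /b -!RintegralZ_itv// -RintegralD_itv.
  - by apply: eq_Rintegral => y; rewrite inE/= in_itv/= => /gE.
  - exact: (bounded_measurableM (bounded_measurable_cst al)).
  - exact: (bounded_measurableM (bounded_measurable_cst be)).
have kE y : 0 <= y <= 1 -> cot (pi * (x - y)) * f y = k y.
  move=> y01; rewrite /k; have [->|fy] := eqVneq (f y) 0; first by rewrite !mulr0.
  by rewrite cut_cotE// away.
rewrite /pv_cintegral.
rewrite (@lin (cos (th * x)) (sin (th * x))); last 2 first.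
- move=> y y01; rewrite /cexpi /= -/th !(mul0r, mulr0, subr0, addr0).
  by rewrite -[_ * cot _ * _]mulrA kE// mulrBr cosB; ring.
- by move=> y y01 fy; rewrite /cexpi /= fy !(mul0r, mulr0, subr0, addr0).
rewrite (@lin (sin (th * x)) (- cos (th * x))); last 2 first.
- move=> y y01; rewrite /cexpi /= -/th !(mul0r, mulr0, subr0, addr0, add0r).
  by rewrite -[_ * cot _ * _]mulrA kE// mulrBr sinB; ring.
- by move=> y y01 fy; rewrite /cexpi /= fy !(mul0r, mulr0, subr0, addr0).
rewrite /= -sqrtr_sqr ler_wsqrtr//.
rewrite -/(k _) -/b.
have -> : (cos (th * x) * a + sin (th * x) * b) ^+ 2 +
   (sin (th * x) * a + - cos (th * x) * b) ^+ 2 =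
   (cos (th * x) ^+ 2 + sin (th * x) ^+ 2) * (a ^+ 2 + b ^+ 2) by ring.
by rewrite cos2Dsin2 mul1r lerDr sqr_ge0.
Qed.

End operator.

(** * The function of a tower *)

Section tower_function.
Variable R : realType.
Local Notation leb := (@lebesgue_measure R).
Variables (N L : nat) (kap : nat -> nat) (T : tower R).
Variables (cnt : nat -> nat) (mass : nat -> R) (m1 m2 : R).
Hypothesis specT : tower_spec N L kap T cnt mass m1 m2.

(** Leaf [v] is contracted into [0, 1/4], where cot (pi t) has the sign of t
    and is comparable to 1 / t.  The mass of the leaf sits in the third quarter
    of the contracted interval, and the points x will be taken in its first
    quarter ([window]): this separates x from all of the mass. *)
Definition core (v : T) : set R :=
  `[lo v / 4 + width v / 8, lo v / 4 + width v * (3 / 16)]%classic.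

Definition window (u : T) (x : R) := lo u / 4 <= x <= lo u / 4 + width u / 16.

(** A Riesz product with square waves instead of cosines. *)
Definition riesz (freq : T -> nat) i (v : T) (y : R) : R :=
  \prod_(u : T) (1 + sgn_of R (side i u v) * square_wave ((freq u)%:R * y)).

Definition layer (freq : T -> nat) i (y : R) : R :=
  \sum_(v : T | carries i v) \1_(core v) y * riesz freq i v y.

Definition tower_fun (w : nat -> R) (freq : T -> nat) (y : R) : R :=
  \sum_(i < N) w i * layer freq i (frac_part y).

Lemma reach_gt0 (u v : T) : 0 < reach u v.
Proof.
have := width_gt0 specT u; have := width_gt0 specT v; rewrite /reach lt_max.
by have [|] := lerP (lo u) (lo v); move=> *; apply/orP; [left|right]; lra.
Qed.

Lemma core_bound (v : T) y : core v y -> 0 < y < 4^-1.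
Proof.
rewrite /core/= in_itv/= => /andP[y1 y2].
have := width_gt0 specT v; have := lo_ge0 specT v; have := hi_le1 specT v.
by move=> *; apply/andP; split; lra.
Qed.

(** The mass and the windows are separated also inside a leaf and between
    adjacent leaves. *)
Lemma window_core_dist d (u v : T) x y : (forall u : T, d <= width u / 16) ->
  window u x -> core v y -> d <= `|x - y| <= 4^-1.
Proof.
rewrite /window /core/= in_itv/= => dw /andP[x1 x2] /andP[y1 y2].
have := width_gt0 specT v; have := lo_ge0 specT v; have := hi_le1 specT v.
have := width_gt0 specT u; have := lo_ge0 specT u; have := hi_le1 specT u.
move=> hu lu wu hv lv wv.
apply/andP; split; last by rewrite ler_norml; apply/andP; split; lra.
have du := dw u; have dv := dw v.
rewrite ler_normr; apply/orP.
have [uv|/(leaf_disjoint specT)[uv|vu]] := eqVneq u v.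
- by subst v; right; lra.
- by right; lra.
- by left; lra.
Qed.

Lemma window_core_side i (u v : T) x y b : side i u v = Some b ->
  window u x -> core v y ->
  0 < (if b then y - x else x - y) <= reach u v / 4.
Proof.
move=> /(side_sep specT); rewrite /window /core/= in_itv/=.
move=> sep /andP[x1 x2] /andP[y1 y2].
have := width_gt0 specT v; have := width_gt0 specT u => wu wv.
have r1 : lo v + width v - lo u <= reach u v by rewrite /reach le_max lexx.
have r2 : lo u + width u - lo v <= reach u v by rewrite /reach le_max lexx orbT.
by case: b sep => sep; apply/andP; split; lra.
Qed.

Lemma riesz_ge0 freq i v y : 0 <= riesz freq i v y.
Proof.
apply: prodr_ge0 => u _; rewrite -lerBlDl sub0r.
have : `|sgn_of R (side i u v) * square_wave ((freq u)%:R * y)| <= 1.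
  by rewrite normrM norm_square_wave mulr1 norm_sgn_of_le.
by rewrite ler_norml => /andP[].
Qed.

Lemma bounded_measurable_core (v : T) : bounded_measurable (\1_(core v) : R -> R).
Proof. by apply: bounded_measurable_indic; exact: measurable_itv. Qed.

Lemma test_wave_square (s : option bool) n y :
  test_wave (false, s) n y = 1 + sgn_of R s * square_wave (n%:R * y).
Proof. by rewrite /test_wave mul1r. Qed.

Lemma bounded_measurable_riesz freq i v : bounded_measurable (riesz freq i v).
Proof.
apply: bounded_measurable_prod => u.
rewrite (_ : (fun y => _) = test_wave (false, side i u v) (freq u)).
  exact: bounded_measurable_test_wave.
by apply/funext => y; rewrite test_wave_square.
Qed.

Lemma bounded_measurable_layer freq i : bounded_measurable (layer freq i).
Proof.
rewrite (_ : layer _ _ = fun y => \sum_(v : T)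
    (if carries i v then \1_(core v) y * riesz freq i v y else 0)).
  apply: bounded_measurable_sum => v; case: (carries i v).
    apply: bounded_measurableM; first exact: bounded_measurable_core.
    exact: bounded_measurable_riesz.
  exact: bounded_measurable_cst.
by apply/funext => y; rewrite /layer big_mkcond.
Qed.

Lemma layer_frac_itv freq i y : 0 <= y <= 1 -> layer freq i (frac_part y) = layer freq i y.
Proof.
move=> /andP[y0]; rewrite le_eqVlt => /predU1P[->|y1]; last first.
  by rewrite (@frac_part_itv _ 0) ?subr0// y0.
have l0 z : (z == 0) || (z == 1) -> layer freq i z = 0.
  move=> z01; rewrite /layer big1// => v _.
  rewrite indicE memNset ?mul0r// => /core_bound /andP[z1 z2].
  by case/orP: z01 z1 z2 => /eqP ->; lra.
by rewrite !l0 ?eqxx ?orbT// /frac_part floor1 subrr eqxx.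
Qed.

Lemma tower_fun_itv w freq y : 0 <= y <= 1 ->
  tower_fun w freq y = \sum_(i < N) w i * layer freq i y.
Proof. by move=> y01; apply: eq_bigr => i _; rewrite layer_frac_itv. Qed.

Lemma bounded_measurable_tower_fun w freq : bounded_measurable (tower_fun w freq).
Proof.
apply: bounded_measurable_sum => i; apply: bounded_measurableM.
  exact: bounded_measurable_cst.
have [ml [M lM]] := bounded_measurable_layer freq i.
split; first by apply: measurableT_comp => //; exact: measurable_frac_part.
by exists M => x; exact: lM.
Qed.

Lemma prod_test_wave_sin (m : T) (freq : T -> nat) i v y :
  \prod_(u : T) test_wave ([ffun u => (u == m, side i u v)] u) (freq u) y =
  sin (2 * pi * (freq m)%:R * y) * riesz freq i v y.
Proof.
under eq_bigr do rewrite ffunE /test_wave/=.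
rewrite big_split/=; congr (_ * _).
by rewrite -big_mkcond big_pred1_eq.
Qed.

Lemma prod_test_wave (freq : T -> nat) i v y :
  \prod_(u : T) test_wave ([ffun u => (false, side i u v)] u) (freq u) y =
  riesz freq i v y.
Proof. by apply: eq_bigr => u _; rewrite ffunE test_wave_square. Qed.

Lemma prod_test_mean_sin (m : T) i v :
  \prod_(u : T) test_mean R ([ffun u => (u == m, side i u v)] u) =
  sgn_of R (side i m v) * (2 / pi).
Proof.
rewrite (bigD1 m)//= ffunE /test_mean /= eqxx big1 ?mulr1// => u um.
by rewrite ffunE /= (negbTE um).
Qed.

Lemma prod_test_mean i v :
  \prod_(u : T) test_mean R ([ffun u => (false, side i u v)] u) = 1.
Proof. by rewrite big1// => u _; rewrite ffunE. Qed.

Lemma Rintegral_core (v : T) : \int[leb]_(y in `[0, 1]) \1_(core v) y = width v / 16.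
Proof.
have h1 := width_gt0 specT v; have h2 := lo_ge0 specT v; have h3 := hi_le1 specT v.
have mc : measurable (core v) by exact: measurable_itv.
rewrite /Rintegral integral_indic// setIidl.
  rewrite /core/= lebesgue_measure_itv/= lte_fin ifT; last by lra.
  by rewrite -EFinB/=; field.
by move=> y /core_bound /andP[y0 y1]/=; rewrite in_itv/=; apply/andP; split; lra.
Qed.

(** The sign of the constraint compensates the sign of the kernel. *)
Lemma core_cot_ge d i (m v : T) x b : 0 < d <= 4^-1 ->
  (forall u : T, d <= width u / 16) -> window m x -> side i m v = Some b ->
  width v / (32 * reach m v) <=
  - (sgn_of R (side i m v) *
     \int[leb]_(y in `[0, 1]) (cut_cot d (x - y) * \1_(core v) y)).
Proof.
move=> d01 dw wx sb; rewrite sb.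
have r0 := reach_gt0 m v; have wv := width_gt0 specT v.
have -> : width v / (32 * reach m v) =
    \int[leb]_(y in `[0, 1]) ((2 * reach m v)^-1 * \1_(core v) y).
  rewrite RintegralZ_itv; last exact: bounded_measurable_core.
  by rewrite Rintegral_core; field; rewrite gt_eqF.
have bk := bounded_measurableM (bounded_measurable_cut_cot d01 x)
  (bounded_measurable_core v).
rewrite -mulNr -RintegralZ_itv//; apply: le_Rintegral_itv.
- exact: (bounded_measurableM (bounded_measurable_cst _) (bounded_measurable_core v)).
- exact: (bounded_measurableM (bounded_measurable_cst _) bk).
move=> y _; rewrite indicE.
have [yv|yv] := boolP (y \in core v); last by rewrite !mulr0.
rewrite inE in yv; rewrite !mulr1.
rewrite cut_cotE//; last exact: (window_core_dist dw wx yv).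
have /andP[s0 s1] := window_core_side sb wx yv.
have /andP[_ xy] := window_core_dist dw wx yv.
case: b sb s0 s1 => /= _ s0 s1; rewrite ?mulN1r ?opprK ?mul1r.
- rewrite -cotN -mulrN opprB; apply: le_trans (cot_ge _).
    by rewrite lef_pV2 ?posrE ?mulr_gt0//; lra.
  by rewrite s0/=; move: xy; rewrite ler_norml => /andP[]; lra.
- apply: le_trans (cot_ge _).
    by rewrite lef_pV2 ?posrE ?mulr_gt0//; lra.
  by rewrite s0/=; move: xy; rewrite ler_norml => /andP[]; lra.
Qed.

End tower_function.

Section tower_bound.
Variable R : realType.
Local Notation leb := (@lebesgue_measure R).
Variables (N L : nat) (kap : nat -> nat) (T : tower R).
Variables (cnt : nat -> nat) (mass : nat -> R) (m1 m2 : R).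
Hypothesis specT : tower_spec N L kap T cnt mass m1 m2.
Variables (n : nat -> nat) (w : nat -> R).
Hypothesis w_ge0 : forall i, 0 <= w i.

Lemma min_width : exists2 d : R, 0 < d <= 4^-1 & forall u : T, d <= width u / 16.
Proof.
exists (\big[Num.min/4^-1]_(u : T) (width u / 16)).
  apply/andP; split; last exact: bigmin_le_id.
  by apply/bigmin_gtP; split => [|u _]; rewrite ?invr_gt0// divr_gt0// (width_gt0 specT).
by move=> u; exact: bigmin_le.
Qed.

Lemma riesz_le (freq : T -> nat) i v y : riesz freq i v y <= 2 ^+ #|T|.
Proof.
rewrite -prodr_const; apply: ler_prod => u _.
have : `|sgn_of R (side i u v) * square_wave ((freq u)%:R * y)| <= 1.
  by rewrite normrM norm_square_wave mulr1 norm_sgn_of_le.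
by rewrite ler_norml => /andP[] *; apply/andP; split; lra.
Qed.

Lemma layer_ge0 (freq : T -> nat) i y : 0 <= layer freq i y.
Proof.
by apply: sumr_ge0 => v _; rewrite mulr_ge0 ?riesz_ge0// indicE.
Qed.

Lemma layer_le (freq : T -> nat) i y : layer freq i y <= #|T|%:R * 2 ^+ #|T|.
Proof.
rewrite /layer big_mkcond mulr_natl -sumr_const; apply: ler_sum => v _.
case: ifP => _; last exact: exprn_ge0.
rewrite -[leRHS]mul1r ler_pM ?riesz_ge0 ?riesz_le// indicE// lern1 leq_b1.
Qed.

Definition height_bound := (\sum_(i < N) w i) * (#|T|%:R * 2 ^+ #|T|).

Lemma tower_fun_ge0 (freq : T -> nat) y : 0 <= tower_fun N w freq y.
Proof. by apply: sumr_ge0 => i _; rewrite mulr_ge0 ?layer_ge0. Qed.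

Lemma tower_fun_le (freq : T -> nat) y : tower_fun N w freq y <= height_bound.
Proof.
by rewrite /height_bound mulr_suml; apply: ler_sum => i _; rewrite ler_wpM2l ?layer_le.
Qed.

(** The sine belongs to the frequency of [m], so it is one of the factors of
    the product of test waves. *)
Lemma sine_integral_expand (freq : T -> nat) (m : T) (k : R -> R) :
  bounded_measurable k ->
  \int[leb]_(y in `[0, 1])
     (sin (2 * pi * (freq m)%:R * y) * (k y * tower_fun N w freq y)) =
  \sum_(i < N) w i * \sum_(v : T | carries i v)
    \int[leb]_(y in `[0, 1]) (k y * \1_(core v) y *
      \prod_(u : T) test_wave ([ffun u => (u == m, side i u v)] u) (freq u) y).
Proof.
move=> bk.
have bin i v : bounded_measurable (fun y => k y * \1_(core v) y *
      \prod_(u : T) test_wave ([ffun u => (u == m, side i u v)] u) (freq u) y).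
  apply: bounded_measurableM.
    by apply: bounded_measurableM => //; exact: bounded_measurable_core.
  by apply: bounded_measurable_prod => u; exact: bounded_measurable_test_wave.
have bif i v : bounded_measurable (fun y => if carries i v then k y * \1_(core v) y *
      \prod_(u : T) test_wave ([ffun u => (u == m, side i u v)] u) (freq u) y else 0).
  by case: (carries i v) => //; exact: bounded_measurable_cst.
under [RHS]eq_bigr => i _.
  rewrite big_mkcond /=.
  rewrite (eq_bigr (fun v => \int[leb]_(y in `[0, 1])
      (if carries i v then k y * \1_(core v) y *
      \prod_(u : T) test_wave ([ffun u => (u == m, side i u v)] u) (freq u) y else 0))); last first.
    by move=> v _; case: (carries i v) => //; rewrite Rintegral_cst// mul0r.
  rewrite -Rintegral_sum_itv; last exact: bif.
  rewrite -RintegralZ_itv; last by apply: bounded_measurable_sum; exact: bif.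
  over.
rewrite -Rintegral_sum_itv; last first.
  move=> i; apply: (bounded_measurableM (bounded_measurable_cst (w i))).
  by apply: bounded_measurable_sum; exact: bif.
apply: eq_Rintegral => y; rewrite inE/= in_itv/= => y01.
rewrite (tower_fun_itv specT)// !mulr_sumr; apply: eq_bigr => i _.
rewrite -big_mkcond /= /layer !mulr_sumr; apply: eq_bigr => v _.
by rewrite prod_test_wave_sin; ring.
Qed.

(** A finite net in a window; only its points enter the choice of the
    frequencies. *)
Lemma net_point (P : nat) (m : T) x : window m x ->
  exists p : 'I_P.+2, `|x - (lo m / 4 + width m / 16 * (p%:R / P.+1%:R))| <= P.+1%:R^-1
    /\ window m (lo m / 4 + width m / 16 * (p%:R / P.+1%:R)).
Proof.
move=> /andP[x1 x2].
have w0 := width_gt0 specT m; have h := hi_le1 specT m; have l0 := lo_ge0 specT m.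
have P0 : 0 < P.+1%:R :> R by rewrite ltr0n.
pose t := (x - lo m / 4) / (width m / 16).
have xE : x = lo m / 4 + width m / 16 * t by rewrite /t; field; rewrite gt_eqF.
have t01 : 0 <= t <= 1.
  by rewrite /t divr_ge0 ?subr_ge0 ?ler_pdivrMr/=; lra.
have tP : 0 <= t * P.+1%:R by rewrite mulr_ge0; lra.
have /andP[q1 q2] := truncn_itv tP.
pose q := Num.truncn (t * P.+1%:R).
have qP : (q < P.+2)%N.
  by rewrite ltnS -(ler_nat R) (le_trans q1)// ler_piMl; lra.
have qt : q%:R / P.+1%:R <= t by rewrite ler_pdivrMr.
have tq : t <= q%:R / P.+1%:R + P.+1%:R^-1.
  by rewrite -[X in _ + X]mul1r -mulrDl ler_pdivlMr// natr1 ltW.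
have q0 : 0 <= q%:R / P.+1%:R :> R by rewrite divr_ge0.
exists (Ordinal qP) => /=.
set a := q%:R / P.+1%:R in qt tq q0 *; set b := P.+1%:R^-1 in tq *; split.
  rewrite [X in `|X - _|]xE opprD addrACA subrr add0r -mulrBr ger0_norm.
    by apply: (@le_trans _ _ (1 * b)); [apply: ler_pM|rewrite mul1r]; lra.
  by rewrite mulr_ge0; lra.
apply/andP; split; first by rewrite lerDl mulr_ge0; lra.
by rewrite lerD2l -[leRHS]mulr1 ler_wpM2l; lra.
Qed.

(** The frequencies are chosen for the characteristic functions of the cores,
    which yields the measures of the level sets, and for these functions times
    the kernel at the points of a net.  At frequency [m] the mass that has no
    constraint from [m] averages to 0, and the rest contributes with one sign. *)
Lemma tower_bound (e : R) : (n @ \oo --> \oo)%classic -> 0 < e ->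
  exists nu : T -> nat, let freq u := n (nu u) in
  (forall i, (i < N)%N ->
    `|\int[leb]_(y in `[0, 1]) layer freq i y - \sum_(v : T | carries i v) width v / 16|
      <= e) /\
  (forall m x, window m x ->
   ((\sum_(i < N) w i * ((16 * pi)^-1 *
      \sum_(v : T | carries i v && (side i m v != None)) width v / reach m v) - e)%:E
     <= lac_carleson n (tower_fun N w freq) x)%E).
Proof.
move=> noo e0.
have [d d01 dw] := min_width.
pose F := height_bound + 1.
have sw0 : 0 <= \sum_(i < N) w i by apply: sumr_ge0.
have F0 : 0 < F.
  by rewrite /F ltr_wpDl// mulr_ge0// mulr_ge0// exprn_ge0.
have eF0 : 0 < e / 2 / F by rewrite !divr_gt0.
(* P + 1 steps make the net fine enough to move x at a cost of e / 2. *)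
have [r r0 hr] := continuous_itv_unif (-1) 1 (continuous_cut_cot d01) eF0.
pose P := Num.truncn r^-1.
have Pr : P.+1%:R^-1 < r.
  by rewrite invf_plt ?posrE ?ltr0n// truncnS_gt.
pose xp (m : T) (p : 'I_P.+2) := lo m / 4 + width m / 16 * (p%:R / P.+1%:R).
pose A := (T + (T * 'I_P.+2) * T)%type.
pose g (al : A) (y : R) : R := match al with
  | inl v => \1_(core v) y
  | inr (mp, v) => cut_cot d (xp mp.1 mp.2 - y) * \1_(core v) y
  end.
have bg al : bounded_measurable (g al).
  case: al => [v|[mp v]] /=; first exact: bounded_measurable_core.
  apply: bounded_measurableM; last exact: bounded_measurable_core.
  exact: bounded_measurable_cut_cot.
(* The averages are to be exact up to e / 2 after summation over all layers and
   leaves. *)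
pose W := (\sum_(i < N) w i + 1) * (#|T|%:R + 1).
have W0 : 0 < W by rewrite mulr_gt0// ltr_wpDl.
pose eta := e / 2 / W.
have eta0 : 0 < eta by rewrite !divr_gt0.
have Weta : W * eta = e / 2 by rewrite /eta; field; rewrite gt_eqF.
have [nu hnu] := frequency_selection bg noo (index_enum_uniq T) eta0.
exists nu => freq; split.
- move=> i iN.
  have bin v : bounded_measurable (fun y =>
      if carries i v then \1_(core v) y * riesz freq i v y else 0).
    case: (carries i v); last exact: bounded_measurable_cst.
    apply: bounded_measurableM; first exact: bounded_measurable_core.
    exact: bounded_measurable_riesz.
  have -> : \int[leb]_(y in `[0, 1]) layer freq i y = \sum_(v : T | carries i v)
      \int[leb]_(y in `[0, 1]) (\1_(core v) y * riesz freq i v y).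
    rewrite [RHS]big_mkcond/=.
    rewrite [RHS](eq_bigr (fun v => \int[leb]_(y in `[0, 1])
       (if carries i v then \1_(core v) y * riesz freq i v y else 0))); last first.
      by move=> v _; case: (carries i v) => //; rewrite Rintegral_cst// mul0r.
    rewrite -Rintegral_sum_itv//; apply: eq_Rintegral => y _.
    by rewrite /layer big_mkcond.
  rewrite -sumrB (le_trans (ler_norm_sum _ _ _))//.
  apply: (@le_trans _ _ (\sum_(v : T) eta)).
    rewrite big_mkcond/=; apply: ler_sum => v _; case: ifP => _; last exact: ltW.
    have := hnu (inl v) [ffun u => (false, side i u v)].
    rewrite prod_test_mean mul1r /= (Rintegral_core specT).
    by under eq_Rintegral do rewrite prod_test_wave.
  rewrite sumr_const -[leLHS]mulr_natl.
  apply: (@le_trans _ _ (W * eta)); last by rewrite Weta; lra.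
  rewrite ler_pM2r// /W; set c := #|T|%:R; have c0 : 0 <= c :> R by [].
  nra.
- move=> m x wx.
  have [p [xxp wp]] := net_point P wx; rewrite -/(xp m p) in xxp wp.
  have away y : 0 <= y <= 1 -> tower_fun N w freq y != 0 -> d <= `|x - y| <= 4^-1.
    move=> y01; rewrite (tower_fun_itv specT)// => fy.
    have [v yv] : exists v : T, core v y.
      apply: contrapT => nv; move/eqP: fy; apply.
      rewrite big1// => i _; rewrite /layer big1 ?mulr0// => v _.
      by rewrite indicE memNset ?mul0r// => yv; apply: nv; exists v.
    exact: (window_core_dist specT dw wx yv).
  apply: le_trans (lac_carleson_ge n (nu m) d01
    (bounded_measurable_tower_fun N w freq) away).
  rewrite lee_fin.
  pose b z := \int[leb]_(y in `[0, 1])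
      (sin (2 * pi * (freq m)%:R * y) * (cut_cot d (z - y) * tower_fun N w freq y)).
  rewrite -/(b x).
  have bf := bounded_measurable_tower_fun N w freq.
  have bz z : bounded_measurable (fun y =>
      sin (2 * pi * (freq m)%:R * y) * (cut_cot d (z - y) * tower_fun N w freq y)).
    apply: bounded_measurableM; first exact: bounded_measurable_sin_scale.
    by apply: bounded_measurableM => //; exact: bounded_measurable_cut_cot.
  have bclose : `|b x - b (xp m p)| <= e / 2.
    rewrite /b -RintegralB_itv//.
    have -> : e / 2 = (e / 2 / F * F) * (1 - 0).
      by rewrite divfK ?gt_eqF// subr0 mulr1.
    apply: Rintegral_itv_le_bound => //.
      apply: (bounded_measurableD (bz x)).
      have := bounded_measurableM (bounded_measurable_cst (-1)) (bz (xp m p)).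
      by under eq_fun do rewrite mulN1r.
    move=> y /andP[y0 y1].
    rewrite -mulrBr -mulrBl normrM -[leRHS]mul1r ler_pM ?sin_max//.
    rewrite normrM ler_pM//.
      apply/ltW/hr; last by rewrite opprB addrA subrK (le_lt_trans xxp).
      move: wx; rewrite /window => /andP[x1 x2].
      have := width_gt0 specT m; have := lo_ge0 specT m; have := hi_le1 specT m => h1 h2 h3.
      by apply/andP; split; lra.
    rewrite ger0_norm ?tower_fun_ge0// (le_trans (tower_fun_le _ _))//.
    by rewrite /F lerDl.
  have bp : \sum_(i < N) w i * ((16 * pi)^-1 *
      \sum_(v : T | carries i v && (side i m v != None)) width v / reach m v) - e / 2
      <= - b (xp m p).
    rewrite /b sine_integral_expand; last exact: bounded_measurable_cut_cot.
    rewrite -sumrN.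
    apply: (@le_trans _ _ (\sum_(i < N) (w i * ((16 * pi)^-1 *
      \sum_(v : T | carries i v && (side i m v != None)) width v / reach m v) -
      w i * (#|T|%:R * eta)))).
      rewrite sumrB lerD2l lerN2 -mulr_suml -Weta mulrA ler_pM2r// /W.
      set c := #|T|%:R; have c0 : 0 <= c :> R by [].
      nra.
    apply: ler_sum => i _; rewrite -mulrBr -[leRHS]mulrN ler_wpM2l//.
    rewrite big_mkcondr/= mulr_sumr.
    apply: (@le_trans _ _ (\sum_(v : T | carries i v) ((16 * pi)^-1 *
        (if side i m v != None then width v / reach m v else 0) - eta))).
      rewrite sumrB lerD2l lerN2 sumr_const -[leLHS]mulr_natl.
      by rewrite ler_pM2r// ler_nat max_card.
    rewrite -sumrN; apply: ler_sum => v _.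
    have := hnu (inr ((m, p), v)) [ffun u => (u == m, side i u v)].
    rewrite prod_test_mean_sin /=.
    set I := Rintegral _ _ _; set J := Rintegral _ _ _ => IJ.
    have : (16 * pi)^-1 * (if side i m v != None then width v / reach m v else 0)
       <= - (sgn_of R (side i m v) * (2 / pi) * J).
      case sE : (side i m v) => [bb|]; last by rewrite /= !mulr0 !mul0r oppr0.
      have := core_cot_ge specT d01 dw wp sE; rewrite -/J sE => cj.
      rewrite mulrAC -mulNr /=.
      have pi0 := pi_gt0 R; have rv := reach_gt0 specT m v.
      apply: le_trans (ler_wpM2r _ cj); last by rewrite divr_ge0 ?ltW.
      rewrite le_eqVlt; apply/orP; left; apply/eqP.
      move: pi0 rv; move: (pi : R) (reach m v) => a c a0 c0.
      by field; rewrite (gt_eqF a0) (gt_eqF c0).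
    move: IJ; rewrite ler_norml; set X := _ * J; set Y := _ * (if _ then _ else _).
    by move=> /andP[] *; lra.
  have := ler_norm (- b x); rewrite normrN.
  by move: bclose; rewrite ler_norml => /andP[]; lra.
Qed.

End tower_bound.

(** * Lorentz norms of layered functions *)

Section lorentz.
Variable R : realType.

(** Straight from the definition by simple functions, hence for functions that
    are not known to be measurable, such as decreasing rearrangements. *)
Lemma le_integral_nonmeasurable d (T : measurableType d)
    (mu : {measure set T -> \bar R}) (D : set T) (f g : T -> \bar R) :
  (forall x, D x -> 0 <= f x)%E -> (forall x, D x -> f x <= g x)%E ->
  (\int[mu]_(x in D) f x <= \int[mu]_(x in D) g x)%E.
Proof.
move=> f0 fg; rewrite !ge0_integralE//; last first.
  by move=> x Dx; exact: le_trans (f0 _ Dx) (fg _ Dx).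
apply: ereal_sup_le => _ [h hf <-]; exists h => // x.
apply: (le_trans (hf x)); rewrite !patchE; case: ifPn => //.
by rewrite inE => /fg.
Qed.

(** Concavity between 0 and s. *)
Lemma concave_dilate (phi : cumulative R R) (t s : R) : lorentz_weight phi ->
  0 <= t <= 1 -> 0 <= s <= 1 -> t * phi s <= phi (t * s).
Proof.
move=> [phi0 cphi] /andP[t0 t1] s01.
have := cphi (Itv01 t0 t1) s 0; rewrite !inE/= !in_itv/= s01 lexx ler01.
move=> /(_ isT isT); rewrite !convRE/= phi0 oppr0 !mulr0 !addr0 mulrN lerN2.
set z := conv _ _ _; suff -> : z = t * s by [].
by rewrite /z /conv/= scaler0 addr0.
Qed.

Lemma stieltjes_itv (phi : cumulative R R) (b : R) : lorentz_weight phi ->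
  0 <= b <= 1 ->
  lebesgue_stieltjes_measure phi (`]0%R, b] `&` `]0%R, 1%R]) = (phi b)%:E.
Proof.
move=> [phi0 _] /andP[b0 b1].
rewrite setIidl; last by apply: subset_itvl; rewrite bnd_simp.
rewrite /lebesgue_stieltjes_measure /measure_extension/=.
rewrite measurable_mu_extE/= ?wlength_itv_bnd//; last exact: is_ocitv.
by rewrite phi0 subr0.
Qed.

Lemma stieltjes_step_integral (phi : cumulative R R) N (c b : nat -> R) :
  lorentz_weight phi -> (forall i, 0 <= c i) ->
  (forall i, (i < N)%N -> 0 <= b i <= 1) ->
  (\int[lebesgue_stieltjes_measure phi]_(s in `]0%R, 1%R])
     \sum_(i < N) (c i)%:E * (\1_(`]0%R, b i]%classic : set R) s)%:E =
   (\sum_(i < N) c i * phi (b i))%:E)%E.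
Proof.
move=> wphi c0 b01.
have mI (i : 'I_N) : measurable_fun [set: R]
   (fun s : R => (\1_(`]0%R, b i]%classic : set R) s : R)%:E).
  by apply/measurable_EFinP; apply: measurable_indic; exact: measurable_itv.
rewrite ge0_integral_sum//; last 2 first.
- by move=> i; apply: measurable_funeM; exact: (measurable_funTS (mI i)).
- by move=> i s _; rewrite mule_ge0// lee_fin// indicE.
rewrite -sumEFin; apply: eq_bigr => i _.
rewrite ge0_integralZl_EFin//; last exact: (measurable_funTS (mI i)).
rewrite integral_indic//.
by rewrite EFinM; congr (_ * _)%E; apply: stieltjes_itv => //; exact: b01.
Qed.

Variables (N : nat) (h sz : nat -> R) (E : nat -> set R).
Hypothesis h_ge0 : forall i, 0 <= h i.
Hypothesis sz_gt0 : forall i, 0 < sz i.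
Hypothesis mE : forall i, measurable (E i).
Variable f : R -> R.
Hypothesis mf : measurable_fun [set: R] f.
Hypothesis fE : forall x, f x = \sum_(i < N) h i * \1_(E i) x.

Let f_ge0 x : 0 <= f x.
Proof. by rewrite fE; apply: sumr_ge0 => i _; rewrite mulr_ge0// indicE. Qed.

Let m_level (l : R) : measurable [set x | l < `|f x|].
Proof.
rewrite [X in measurable X](_ : _ = f @^-1` `]l, +oo[).
  by rewrite -[X in measurable X]setTI; apply: mf => //; exact: measurable_itv.
by apply/seteqP; split => x /=; rewrite in_itv/= andbT ger0_norm.
Qed.

(** The condition selects a tail of the sequence, whose sum is at most twice
    its first term. *)
Lemma geometric_tail (a : nat -> R) (t : R) n : 0 <= t -> (forall i, 0 <= a i) ->
  (forall i, a i.+1 <= a i / 2) ->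
  \sum_(i < n | 4 * a i <= t) 2 * a i <= t.
Proof.
elim: n a => [|n ih] a t0 a0 ha; first by rewrite big_ord0.
have tot m (b : nat -> R) : (forall i, 0 <= b i) -> (forall i, b i.+1 <= b i / 2) ->
    \sum_(i < m) 2 * b i <= 4 * b 0%N.
  elim: m b => [|m ihm] b b0 hb; first by rewrite big_ord0 mulr_ge0.
  rewrite big_ord_recl /=; have := hb 0%N.
  have := ihm (fun i => b i.+1) (fun i => b0 _) (fun i => hb _).
  by rewrite /=; set S := \sum_(_ < _) _; lra.
have [a0t|a0t] := leP (4 * a 0%N) t.
  apply: (le_trans _ a0t); apply: le_trans (tot n.+1 a a0 ha).
  rewrite [leRHS](bigID (fun i : 'I_n.+1 => 4 * a i <= t))/= lerDl.
  by apply: sumr_ge0 => i _; rewrite mulr_ge0.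
rewrite big_mkcond big_ord_recl /= ifF ?add0r; last by apply/negbTE; rewrite -ltNge.
rewrite -big_mkcond /=.
exact: (ih (fun i => a i.+1) t0 (fun i => a0 _) (fun i => ha _)).
Qed.

(** The sum of a sequence that doubles is at most twice its last term. *)
Lemma doubling_sum (a : nat -> R) (Q : nat -> bool) (l : R) n : 0 <= l ->
  (forall i, 0 <= a i) -> (forall i, 2 * a i <= a i.+1) ->
  (forall i, (i < n)%N -> Q i -> a i <= l) ->
  \sum_(i < n | Q i) a i <= 2 * l.
Proof.
move=> l0 a0 ha; elim: n => [|n ih] hl; first by rewrite big_ord0 mulr_ge0.
have pre m : \sum_(i < m) a i <= a m.
  elim: m => [|m ihm]; first by rewrite big_ord0.
  by rewrite big_ord_recr/=; have := ha m; lra.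
rewrite big_mkcond big_ord_recr/= -big_mkcond/=.
have {}ih := ih (fun i im => hl i (ltnW im)).
case: ifP => [Qn|_]; last by rewrite addr0.
have hn := hl n (ltnSn n) Qn.
have : \sum_(i < n | Q i) a i <= \sum_(i < n) a i.
  rewrite [leRHS](bigID (fun i : 'I_n => Q i))/= lerDl.
  by apply: sumr_ge0.
by have := pre n; lra.
Qed.

Section upper.
Hypothesis sz_half : forall i, sz i.+1 <= sz i / 2.
Hypothesis sz_small : 4 * sz 0 <= 1.
Hypothesis E_le : forall i, (i < N)%N ->
  (torus_measure R (E i) <= (2 * sz i)%:E)%E.

(** Where f exceeds the sum, some layer with 4 [sz i] <= s is present, and
    together these layers have measure at most s. *)
Lemma rearrangement_le (s : R) : 0 < s ->
  (decreasing_rearrangement f s <=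
   \sum_(i < N) (h i)%:E * (\1_(`]0%R, 4 * sz i]%classic : set R) s)%:E)%E.
Proof.
move=> s0.
have -> : (\sum_(i < N) (h i)%:E * (\1_(`]0%R, 4 * sz i]%classic : set R) s)%:E =
   (\sum_(i < N) h i * \1_(`]0%R, 4 * sz i]%classic : set R) s)%:E)%E.
  by rewrite -sumEFin; apply: eq_bigr => i _; rewrite EFinM.
apply: ereal_inf_lbound.
set l := \sum_(i < N) _.
exists l => //=; split.
  by apply: sumr_ge0 => i _; rewrite mulr_ge0// indicE.
pose A i := if 4 * sz i <= s then E i else set0.
have mA i : measurable (A i) by rewrite /A; case: ifP.
apply: (@le_trans _ _ (torus_measure R (\big[setU/set0]_(i < N) A i))).
  apply: le_measure.
  - rewrite inE; exact: m_level.
  - by rewrite inE; apply: bigsetU_measurable => i _; exact: mA.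
  move=> x /= lf; apply: contrapT => nA; move: lf; apply/negP; rewrite -leNgt.
  rewrite ger0_norm// fE; apply: ler_sum => i _; rewrite ler_wpM2l//.
  rewrite !indicE; have [xE|] := boolP (x \in E i) => //.
  rewrite mem_set// /= in_itv/= s0/= leNgt; apply/negP => es; apply: nA.
  rewrite -bigcup_mkord; exists (i : nat); first exact: ltn_ord.
  by rewrite /A (ltW es); apply/set_mem.
apply: (le_trans (Boole_inequality (torus_measure R) (n := N) (fun i _ => mA i))).
apply: (@le_trans _ _ (\sum_(i < N | (4 * sz i <= s)%R) (2 * sz i)%:E)%E).
  rewrite [leRHS]big_mkcond/=; apply: lee_sum => i _; rewrite /A.
  by case: ifP => // _; [exact: E_le | rewrite measure0].
by rewrite sumEFin lee_fin; apply: geometric_tail => //; [exact: ltW|move=> i; exact: ltW].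
Qed.

Lemma lorentz_norm_le (phi : cumulative R R) : lorentz_weight phi ->
  (lorentz_norm phi f <= (4 * \sum_(i < N) h i * phi (sz i))%:E)%E.
Proof.
move=> wphi.
have sz4 i : 4 * sz i <= 1.
  elim: i => // i ih; have := sz_half i; have := sz_gt0 i; lra.
apply: (@le_trans _ _ (\sum_(i < N) h i * phi (4 * sz i))%:E).
  rewrite -(stieltjes_step_integral (b := fun i => 4 * sz i))//; last first.
    by move=> i _; rewrite sz4 mulr_ge0// ltW.
  apply: le_integral_nonmeasurable => s /=; rewrite in_itv/= => /andP[s0 s1].
    by apply: le_ereal_inf_tmp => _ [l [l0 _] <-]; rewrite lee_fin.
  exact: rearrangement_le.
rewrite lee_fin mulr_sumr; apply: ler_sum => i _.
rewrite mulrCA ler_wpM2l//.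
have q01 : 0 <= (4^-1 : R) <= 1 by lra.
have e01 : 0 <= 4 * sz i <= 1 by rewrite sz4 mulr_ge0// ltW.
by have := @concave_dilate phi _ _ wphi q01 e01; rewrite mulKf//; lra.
Qed.
End upper.

Section lower.
Hypothesis h_double : forall i, 2 * h i <= h i.+1.
Hypothesis sz_le1 : forall i, sz i <= 1.
Hypothesis E_ge : forall i, (i < N)%N ->
  ((sz i / 2)%:E <= torus_measure R (E i))%E.

(** If E_i has measure more than s, then the rearrangement at s is at least
    h_i; the sum of these h_i is at most twice the largest of them. *)
Lemma rearrangement_ge (s : R) : 0 < s ->
  (\sum_(i < N) (2^-1 * h i)%:E * (\1_(`]0%R, sz i / 4]%classic : set R) s)%:E
   <= decreasing_rearrangement f s)%E.
Proof.
move=> s0.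
have -> : (\sum_(i < N) (2^-1 * h i)%:E * (\1_(`]0%R, sz i / 4]%classic : set R) s)%:E =
   (2^-1 * \sum_(i < N | s <= sz i / 4) h i)%:E)%E.
  rewrite [X in _ = (_ * X)%:E]big_mkcond mulr_sumr -sumEFin; apply: eq_bigr => i _.
  rewrite indicE -EFinM; congr (_%:E); case: ifPn => si.
    by rewrite mem_set ?mulr1//= in_itv/= s0.
  by rewrite memNset ?mulr0//= in_itv/= s0; exact/negP.
apply: le_ereal_inf_tmp => _ [l [l0 hl] <-]; rewrite lee_fin.
rewrite mulrC ler_pdivrMr// mulrC.
apply: (doubling_sum l0 h_ge0 h_double (Q := fun i => s <= sz i / 4)) => i iN si.
rewrite leNgt; apply/negP => lh.
have : (torus_measure R (E i) <= s%:E)%E.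
  apply: le_trans hl; apply: le_measure.
  - by rewrite inE; exact: mE.
  - by rewrite inE; exact: m_level.
  move=> x xE /=; rewrite ger0_norm// (lt_le_trans lh)// fE.
  rewrite (bigD1 (Ordinal iN))//= indicE mem_set// mulr1 lerDl.
  by apply: sumr_ge0 => k _; rewrite mulr_ge0// indicE.
move/(le_trans (E_ge iN)); rewrite lee_fin; have := sz_gt0 i; lra.
Qed.

Lemma lorentz_norm_ge (phi : cumulative R R) : lorentz_weight phi ->
  ((8^-1 * \sum_(i < N) h i * phi (sz i))%:E <= lorentz_norm phi f)%E.
Proof.
move=> wphi.
have sz4 i : 0 <= sz i / 4 <= 1 by have := sz_gt0 i; have := sz_le1 i; lra.
apply: (@le_trans _ _ (\sum_(i < N) (2^-1 * h i) * phi (sz i / 4))%:E).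
  rewrite lee_fin mulr_sumr; apply: ler_sum => i _.
  have q01 : 0 <= (4^-1 : R) <= 1 by lra.
  have e01 : 0 <= sz i <= 1 by rewrite sz_le1 ltW.
  have := @concave_dilate phi _ _ wphi q01 e01; rewrite (mulrC _ (sz i)) => hc.
  have := ler_wpM2l (h_ge0 i) hc; lra.
rewrite -(stieltjes_step_integral (c := fun i => 2^-1 * h i)
  (b := fun i => sz i / 4))//; last by move=> i; rewrite mulr_ge0.
apply: le_integral_nonmeasurable => s /=; rewrite in_itv/= => /andP[s0 s1].
  by apply: sume_ge0 => i _; rewrite mule_ge0// lee_fin// ?mulr_ge0// indicE.
exact: rearrangement_ge.
Qed.
End lower.

End lorentz.

(** * Heights, sizes and weights of the layers *)

Section weights.
Variable R : realType.

Let ln2_gt0 : 0 < ln 2 :> R.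
Proof. by rewrite ln_gt0// ltr1n. Qed.

Lemma log2_le (x y : R) : 0 < x -> x <= y -> log2 x <= log2 y.
Proof.
move=> x0 xy; rewrite /log2 ler_pM2r ?invr_gt0//.
by rewrite ler_ln ?posrE// (lt_le_trans x0).
Qed.

Lemma log2_expn n : log2 (2 ^+ n) = n%:R :> R.
Proof. by rewrite /log2 lnXn// -[ln 2 *+ n]mulr_natl mulfK// gt_eqF. Qed.

Lemma log2_ge_nat n (x : R) : 2 ^+ n <= x -> n%:R <= log2 x.
Proof. by move=> nx; rewrite -log2_expn log2_le// exprn_gt0. Qed.

Lemma log2_le_nat n (x : R) : 0 < x -> x <= 2 ^+ n -> log2 x <= n%:R.
Proof. by move=> x0 xn; rewrite -log2_expn log2_le. Qed.

Variable L : nat.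
Variable cnt : nat -> nat.
Hypothesis cnt_bound :
  forall i, (2 ^ kappa L i <= cnt i <= 2 ^ (L + 2 * kappa L i))%N.

Local Notation N := (2 ^ L)%N.

(** The mass of layer [i] before the factor 1/16 which comes from the cores. *)
Definition block_weight i : R := (N%:R * (kappa L i)%:R)^-1.

Definition block_height i : R := block_weight i * 2 ^+ L * 2 ^+ cnt i.

(** The measure of the support of layer [i], up to a factor 2: the leaves that
    carry the layer fill a part 2^-L of the interval, their cores a part 2^-4
    of that, and [cnt i] square waves halve it [cnt i] times. *)
Definition block_size i : R := (2 ^+ (cnt i + L + 4))^-1.

Let natX k : (2 ^ k)%:R = 2 ^+ k :> R. Proof. by rewrite natrX. Qed.

Lemma kappa_gt0 i : (0 < kappa L i)%N. Proof. by rewrite expn_gt0. Qed.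

Lemma block_weight_gt0 i : 0 < block_weight i.
Proof. by rewrite invr_gt0 mulr_gt0// ltr0n ?expn_gt0// kappa_gt0. Qed.

Lemma block_size_gt0 i : 0 < block_size i.
Proof. by rewrite invr_gt0 exprn_gt0. Qed.

Lemma block_height_gt0 i : 0 < block_height i.
Proof. by rewrite !mulr_gt0 ?exprn_gt0// block_weight_gt0. Qed.

Lemma height_size i : block_height i * block_size i = block_weight i / 16.
Proof.
rewrite /block_height /block_size !exprD.
have h1 : 2 ^+ cnt i != 0 :> R by rewrite expf_neq0.
have h2 : 2 ^+ L != 0 :> R by rewrite expf_neq0.
by field; rewrite h1 h2.
Qed.

Lemma kappa_big i : (L + 4 <= kappa L i)%N.
Proof.
apply: leq_trans (kappa_ge L i); rewrite expnD -[(2 ^ 2)%N]/4%N.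
have := ltn_2expn L; lia.
Qed.

(** The heights and the sizes of consecutive layers are far apart because
    [cnt i] is at most exponential in [kappa L i], and [cnt i.+1] at least
    exponential in a much larger number. *)
Lemma cnt_step i : (cnt i + (L + 3) <= cnt i.+1)%N.
Proof.
have /andP[_ h1] := cnt_bound i; have /andP[h2 _] := cnt_bound i.+1.
apply: leq_trans h2; have kb := kappa_big i.
apply: (@leq_trans (2 ^ (L + 2 * kappa L i).+1)%N).
  rewrite expnS mul2n -addnn leq_add//.
  by apply: leq_trans (ltnW (ltn_2expn _)); lia.
rewrite leq_exp2l// kappaS expnD -[(2 ^ 2)%N]/4%N.
by have := ltn_2expn L; set a := (2 ^ L)%N; nia.
Qed.

Lemma block_size_half i : block_size i.+1 <= block_size i / 2.
Proof.
rewrite /block_size -invfM -exprSr lef_pV2 ?posrE ?exprn_gt0//.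
by rewrite ler_weXn2l ?ler1n//; have := cnt_step i; lia.
Qed.

Lemma block_size_le i : block_size i <= (2 ^+ (L + 4))^-1.
Proof.
rewrite /block_size lef_pV2 ?posrE ?exprn_gt0//.
by rewrite ler_weXn2l ?ler1n//; lia.
Qed.

Lemma block_height_double i : 2 * block_height i <= block_height i.+1.
Proof.
have -> : block_height i.+1 =
    block_weight i * 2 ^+ L * 2 ^+ cnt i.+1 / 2 ^+ (L + 2).
  rewrite /block_height /block_weight kappaS natrM (natX (L + 2)).
  have k0 : (kappa L i)%:R != 0 :> R by rewrite pnatr_eq0 -lt0n kappa_gt0.
  have h1 : N%:R != 0 :> R by rewrite pnatr_eq0 -lt0n expn_gt0.
  have h2 : 2 ^+ (L + 2) != 0 :> R by rewrite expf_neq0.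
  move: k0 h1 h2.
  move: ((kappa L i)%:R : R) (N%:R : R) (2 ^+ (L + 2) : R) => a b c ha hb hc.
  by field; rewrite ha hb hc.
rewrite ler_pdivlMr ?exprn_gt0//.
have -> : 2 * block_height i * 2 ^+ (L + 2) =
    block_weight i * 2 ^+ L * 2 ^+ (cnt i + (L + 3)).
  by rewrite /block_height !exprD; ring.
rewrite ler_pM2l ?mulr_gt0 ?exprn_gt0 ?block_weight_gt0//.
by rewrite ler_weXn2l ?ler1n// cnt_step.
Qed.

Let cnt_pow i c : (c <= L + 10)%N -> (0 < L)%N ->
  (cnt i + c <= 2 ^ (3 * kappa L i))%N.
Proof.
move=> cL L0; have /andP[_ h1] := cnt_bound i; have kb := kappa_big i.
apply: (@leq_trans (2 ^ (L + 2 * kappa L i).+1)%N).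
  rewrite expnS mul2n -addnn leq_add//.
  apply: (leq_trans cL).
  by apply: leq_trans (ltnW (ltn_2expn _)); lia.
by rewrite leq_exp2l//; lia.
Qed.

Let avg_cst (c : R) : \sum_(i < N) (c / N%:R) = c.
Proof.
have N0 : N%:R != 0 :> R by rewrite pnatr_eq0 -lt0n expn_gt0.
rewrite sumr_const card_ord; move: N0; set M := (2 ^ L)%N => N0.
by rewrite -[LHS]mulr_natr divfK.
Qed.

Section first_weight.
Variable mu : cumulative R R.
Hypothesis L_gt0 : (0 < L)%N.
Hypothesis muE : forall i, mu (block_size i) =
  block_size i * log2 (log2 (4 / block_size i)).

(** log2 (4 / size) is [cnt i] up to a bounded multiple of L, and log2 (cnt i)
    is of order [kappa L i]. *)
Lemma mu_ratio i : (kappa L i)%:R <= log2 (log2 (4 / block_size i)) <= 3 * (kappa L i)%:R.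
Proof.
rewrite /block_size invrK (_ : 4 = 2 ^+ 2); last by rewrite -natX.
rewrite -exprD log2_expn; apply/andP; split.
  rewrite log2_ge_nat// -natX ler_nat.
  by have /andP[] := cnt_bound i; lia.
rewrite -natrM log2_le_nat//.
rewrite -natX ler_nat; have := @cnt_pow i (L + 6) _ L_gt0; lia.
Qed.

Lemma mu_sum : 16^-1 <= \sum_(i < N) block_height i * mu (block_size i) <= 3 / 16.
Proof.
have E := avg_cst.
have T i : block_height i * mu (block_size i) =
    (log2 (log2 (4 / block_size i)) / (kappa L i)%:R / 16) / N%:R.
  rewrite muE mulrA height_size /block_weight invfM.
  by set a := N%:R^-1; set b := (kappa L i)%:R^-1; set c := log2 _; ring.
have k0 i : 0 < (kappa L i)%:R :> R by rewrite ltr0n kappa_gt0.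
have N0 : 0 < N%:R :> R by rewrite ltr0n expn_gt0.
apply/andP; split; [rewrite -[leLHS]E|rewrite -[leRHS]E];
  apply: ler_sum => i _; rewrite T ler_pM2r ?invr_gt0//;
  have /andP[h1 h2] := mu_ratio i.
- by rewrite -[leLHS]mul1r ler_pM2r// ler_pdivlMr// mul1r.
- by rewrite ler_pM2r// ler_pdivrMr.
Qed.

End first_weight.

Section second_weight.
Variable phi : cumulative R R.
Hypothesis L_gt0 : (0 < L)%N.
Hypothesis phiE : forall i, phi (block_size i) =
  block_size i * log2 (log2 (17 / block_size i)) *
  log2 (log2 (log2 (log2 (17 / block_size i)))).

Let x i : R := log2 (log2 (17 / block_size i)).

Lemma phi_ratio i : (kappa L i)%:R <= x i <= 3 * (kappa L i)%:R.
Proof.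
have b0 := block_size_gt0 i.
have y1 : (cnt i + L + 8)%:R <= log2 (17 / block_size i) :> R.
  rewrite log2_ge_nat// /block_size invrK
    (_ : (cnt i + L + 8 = 4 + (cnt i + L + 4))%N); last by lia.
  by rewrite exprD ler_pM2r ?exprn_gt0// -natX ler_nat.
have y2 : log2 (17 / block_size i) <= (cnt i + L + 9)%:R :> R.
  rewrite log2_le_nat ?divr_gt0// /block_size invrK
    (_ : (cnt i + L + 9 = 5 + (cnt i + L + 4))%N); last by lia.
  by rewrite (exprD 2 5) ler_pM2r ?exprn_gt0// -natX ler_nat.
apply/andP; split.
  rewrite log2_ge_nat// (le_trans _ y1)// -natX ler_nat.
  by have /andP[] := cnt_bound i; lia.
rewrite -natrM log2_le_nat//; first by rewrite (lt_le_trans _ y1)// ltr0n; lia.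
rewrite (le_trans y2)// -natX ler_nat; have := @cnt_pow i (L + 9) _ L_gt0; lia.
Qed.

(** log2 log2 of [kappa L i], which is a power of 2 with exponent
    (L + 2)(i + 1), where i + 1 goes up to 2^L. *)
Lemma phi_loglog i : (i < N)%N ->
  log2 ((L + 2)%:R : R) <= log2 (log2 (x i)) <= (2 * L + 3)%:R.
Proof.
move=> iN; have /andP[h1 h2] := phi_ratio i.
have xl : ((L + 2) * i.+1)%:R <= log2 (x i) :> R.
  by rewrite log2_ge_nat// -natX.
have x0 : 0 < x i by rewrite (lt_le_trans _ h1)// ltr0n kappa_gt0.
have xu : log2 (x i) <= ((L + 2) * i.+1 + 2)%:R :> R.
  rewrite log2_le_nat// (le_trans h2)// -natrM -natX ler_nat expnD.
  by rewrite mulnC leq_mul2l -[(2 ^ 2)%N]/4%N orbT.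
have lp : 0 < log2 (x i) by rewrite (lt_le_trans _ xl)// ltr0n muln_gt0; lia.
apply/andP; split.
  rewrite log2_le//.
  by rewrite (le_trans _ xl)// ler_nat leq_pmulr.
rewrite log2_le_nat// (le_trans xu)// -natX ler_nat.
have := ltn_2expn L.
rewrite (_ : (2 ^ (2 * L + 3) = 8 * (2 ^ L * 2 ^ L))%N); last first.
  by rewrite -expnD -[8%N]/(2 ^ 3)%N -expnD; congr (_ ^ _)%N; lia.
by move: iN; set a := (2 ^ L)%N; nia.
Qed.

Lemma phi_sum : 16^-1 * log2 (L + 2)%:R <=
  \sum_(i < N) block_height i * phi (block_size i) <= 3 / 16 * (2 * L + 3)%:R.
Proof.
have E := avg_cst.
have T i : block_height i * phi (block_size i) =
    (x i / (kappa L i)%:R / 16 * log2 (log2 (x i))) / N%:R.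
  have -> : phi (block_size i) = block_size i * x i * log2 (log2 (x i)) := phiE i.
  move: (log2 (log2 (x i))) (x i) => a b.
  rewrite !mulrA height_size /block_weight invfM; set c := N%:R^-1.
  by
  set e := (kappa L i)%:R^-1; ring.
have k0 i : 0 < (kappa L i)%:R :> R by rewrite ltr0n kappa_gt0.
have N0 : 0 < N%:R :> R by rewrite ltr0n expn_gt0.
have l0 : 0 <= log2 (L + 2)%:R :> R.
  by apply: (@log2_ge_nat 0); rewrite expr0 ler1n; lia.
apply/andP; split; [rewrite -[leLHS]E|rewrite -[leRHS]E];
  apply: ler_sum => i _; rewrite T ler_pM2r ?invr_gt0//;
  have /andP[h1 h2] := phi_ratio i; have /andP[h3 h4] := phi_loglog (ltn_ord i).
- rewrite ler_pM//.
  by rewrite -[leLHS]mul1r ler_pM2r// ler_pdivlMr// mul1r.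
- have x0 : 0 <= x i by exact: le_trans h1.
  have ll0 : 0 <= log2 (log2 (x i)) by exact: le_trans h3.
  have xk : x i / (kappa L i)%:R / 16 <= 3 / 16.
    by rewrite ler_pM2r// ler_pdivrMr.
  apply: (ler_pM _ ll0 xk h4).
  by apply: divr_ge0 => //; apply: divr_ge0 => //; exact: ltW (k0 i).
Qed.

End second_weight.
End weights.

(** * Level sets of the layers *)

Section layers.
Variable R : realType.
Local Notation leb := (@lebesgue_measure R).

Lemma torus_measureE (A : set R) : measurable A ->
  torus_measure R A = (\int[leb]_(y in `[0, 1]) \1_A y)%:E.
Proof.
move=> mA; rewrite /Rintegral integral_indic// fineK// ge0_fin_numE//.
apply: (@le_lt_trans _ _ (leb `[0, 1]%classic)).
  apply: le_measure; last exact: subIsetr.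
  - by rewrite inE; apply: measurableI => //; exact: measurable_itv.
  - by rewrite inE; exact: measurable_itv.
by rewrite /= lebesgue_measure_itv/= lte_fin ltr01 -EFinB ltry.
Qed.

Variables (N L : nat) (kap : nat -> nat) (T : tower R).
Variables (cnt : nat -> nat) (mass : nat -> R) (m1 m2 : R).
Hypothesis specT : tower_spec N L kap T cnt mass m1 m2.
Variable freq : T -> nat.

Lemma core_disjoint (u v : T) y : core u y -> core v y -> u = v.
Proof.
rewrite /core/= !in_itv/= => /andP[u1 u2] /andP[v1 v2].
have := width_gt0 specT v; have := width_gt0 specT u => wu wv.
by apply/eqP; apply: contraT => /(leaf_disjoint specT) []; lra.
Qed.

Lemma riesz_val i (v : T) y : carries i v ->
  riesz freq i v y = 0 \/ riesz freq i v y = 2 ^+ cnt i.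
Proof.
move=> cv; rewrite /riesz -(carries_count specT cv).
pose t u := sgn_of R (side i u v) * square_wave ((freq u)%:R * y).
have tE u : t u = (if side i u v != None then 1 else 0) \/ t u = -1.
  rewrite /t /square_wave; case: (side i u v) => [[]|]; case: ifP => _ /=;
    rewrite ?mul1r ?mulr1 ?mulN1r ?opprK ?mul0r; by [left|right].
have [/existsP[u /eqP tu]|/existsPn ht] := boolP [exists u, t u == -1].
  by left; rewrite (bigD1 u)//= -/(t u) tu subrr mul0r.
right; rewrite -prodr_const [RHS]big_mkcond/=; apply: eq_bigr => u _.
rewrite -/(t u); case: (tE u) => [->|tu]; last by move: (ht u); rewrite tu eqxx.
by rewrite inE; case: ifP => _; rewrite ?addr0.
Qed.

(** The cores are disjoint, and the number of factors is the same at all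
    leaves that carry the layer. *)
Lemma layer_val i y : layer freq i y = 0 \/ layer freq i y = 2 ^+ cnt i.
Proof.
have [[v cv yv]|nv] := pselect (exists2 v : T, carries i v & core v y).
  have -> : layer freq i y = riesz freq i v y.
    rewrite /layer (bigD1 v)//= indicE mem_set// mul1r big1 ?addr0// => u /andP[_ uv].
    rewrite indicE memNset ?mul0r// => yu.
    by move/eqP: uv; apply; exact: core_disjoint yv.
  exact: riesz_val.
left; rewrite /layer big1// => v cv.
by rewrite indicE memNset ?mul0r// => yv; apply: nv; exists v.
Qed.

Definition carrier_set i : set R := [set y | layer freq i (frac_part y) != 0].

Lemma measurable_layer_frac i :
  measurable_fun [set: R] (fun y => layer freq i (frac_part y)).
Proof.
have [ml _] := bounded_measurable_layer freq i.
by apply: measurableT_comp => //; exact: measurable_frac_part.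
Qed.

Lemma measurable_carrier_set i : measurable (carrier_set i).
Proof.
rewrite (_ : carrier_set i = ~` ((fun y => layer freq i (frac_part y)) @^-1` [set 0])).
  apply: measurableC; rewrite -[X in measurable X]setTI.
  by apply: measurable_layer_frac => //; exact: measurable_set1.
by apply/seteqP; split => y /= /eqP.
Qed.

Lemma layer_frac i y : layer freq i (frac_part y) = 2 ^+ cnt i * \1_(carrier_set i) y.
Proof.
rewrite indicE; have [y0|y0] := eqVneq (layer freq i (frac_part y)) 0.
  by rewrite y0 memNset ?mulr0// /carrier_set /= y0 eqxx.
rewrite mem_set// mulr1; case: (layer_val i (frac_part y)) => // y0'.
by rewrite y0' eqxx in y0.
Qed.

Lemma carrier_set_measure i :
  torus_measure R (carrier_set i) =
  (\int[leb]_(y in `[0, 1]) layer freq i y / 2 ^+ cnt i)%:E.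
Proof.
have p0 : 2 ^+ cnt i != 0 :> R by rewrite expf_neq0.
have mE := measurable_carrier_set i.
have b1 : bounded_measurable (\1_(carrier_set i) : R -> R).
  exact: bounded_measurable_indic.
have -> : \int[leb]_(y in `[0, 1]) layer freq i y =
   2 ^+ cnt i * \int[leb]_(y in `[0, 1]) \1_(carrier_set i) y.
  rewrite -RintegralZ_itv//; apply: eq_Rintegral => y; rewrite inE/= in_itv/= => y01.
  by rewrite -layer_frac (layer_frac_itv specT).
by rewrite mulrAC divff// mul1r -torus_measureE.
Qed.

Lemma windows_measure (P : pred T) :
  ((\sum_(m | P m) width m / 16)%:E <=
    torus_measure R [set x | exists2 m, P m & window m x])%E.
Proof.
pose W (m : T) : set R := `[lo m / 4, lo m / 4 + width m / 16]%classic.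
have WE m x : W m x = window m x by rewrite /W/= in_itv.
set U := [set x | _].
have UE : U = \bigcup_(m in [set m | P m]) W m.
  apply/seteqP; split => x.
    by move=> [m Pm wm]; exists m => //; rewrite WE.
  by move=> [m Pm]; rewrite WE => wm; exists m.
have mU : measurable U.
  rewrite UE; apply: fin_bigcup_measurable; first exact: finite_finset.
  by move=> m _; exact: measurable_itv.
have bW m : bounded_measurable (\1_(W m) : R -> R).
  by apply: bounded_measurable_indic; exact: measurable_itv.
rewrite torus_measureE//.
rewrite lee_fin.
have -> : \sum_(m | P m) width m / 16 =
   \int[leb]_(y in `[0, 1]) \sum_m (if P m then 1 else 0) * \1_(W m) y.
  rewrite Rintegral_sum_itv; last first.
    by move=> m; exact: (bounded_measurableM (bounded_measurable_cst _)).
  rewrite big_mkcond; apply: eq_bigr => m _; rewrite RintegralZ_itv//.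
  case: ifP => _; rewrite ?mul0r// mul1r.
  have mW : measurable (W m) by exact: measurable_itv.
  have h1 := width_gt0 specT m; have h2 := lo_ge0 specT m; have h3 := hi_le1 specT m.
  rewrite /Rintegral integral_indic// setIidl.
    rewrite /W/= lebesgue_measure_itv/= lte_fin ifT; last by lra.
    by rewrite -EFinB/=; lra.
  by move=> y; rewrite /W/= !in_itv/= => /andP[y0 y1]; apply/andP; split; lra.
apply: le_Rintegral_itv.
- apply: bounded_measurable_sum => m.
  exact: (bounded_measurableM (bounded_measurable_cst _)).
- exact: bounded_measurable_indic.
move=> x _; rewrite indicE; have [xU|xU] := boolP (x \in U).
  move/set_mem : xU => [m Pm wm].
  rewrite (bigD1 m)//= Pm mul1r big1 ?addr0; first by rewrite indicE lern1 leq_b1.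
  move=> u um; rewrite indicE memNset ?mulr0//; rewrite WE => wu.
  have := width_gt0 specT m; have := width_gt0 specT u => h1 h2.
  move: wu wm; rewrite /window => /andP[u1 u2] /andP[v1 v2].
  by case: (leaf_disjoint specT um); lra.
rewrite big1// => m _; case: ifP => Pm; rewrite ?mul0r// mul1r indicE memNset//.
by rewrite WE => wm; move: xU; rewrite notin_setE; apply; exists m.
Qed.

End layers.

(** * Conclusion *)

Section assembly.
Variable R : realType.
Local Notation leb := (@lebesgue_measure R).

(** Ratios greater than 1 force the integers [n j] to increase strictly from
    some index on. *)
Lemma lacunary_cvg_infty (n : nat -> nat) : lacunary R n -> n @ \oo --> \oo.
Proof.
rewrite /lacunary limn_einf_lim.
set u := fun j : nat => _.
have -> : limn (einfs u) = ereal_sup (range (einfs u)).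
  by apply/cvg_lim => //; exact: cvg_einfs_sup.
move=> /ereal_sup_gt [_ [m _ <-] h1].
have inc k : (m <= k)%N -> (n k < n k.+1)%N.
  move=> mk; have : (1 < ((n k.+1)%:R / (n k)%:R : R)%:E)%E.
    apply: (lt_le_trans h1); apply: ereal_inf_lbound => /=.
    by exists k.
  rewrite lte_fin; have [->|nk0] := posnP (n k).
    by rewrite invr0 mulr0 ltr10.
  by rewrite ltr_pdivlMr ?ltr0n// mul1r ltr_nat.
have ge k : (k <= n (m + k))%N.
  elim: k => // k ih; rewrite addnS; apply: leq_ltn_trans ih _.
  by apply: inc; exact: leq_addr.
move=> P [M _ hM]; exists (m + M)%N => // k /= mk; apply: hM => /=.
have := ge (k - m)%N; rewrite subnKC; last by lia.
by lia.
Qed.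

(** Lebesgue measure is an outer measure on all sets, hence monotone on the
    superlevel sets of the operator, too. *)
Lemma le_torus_measure (A B : set R) : A `<=` B ->
  (torus_measure R A <= torus_measure R B)%E.
Proof.
move=> AB; rewrite /torus_measure /= /mrestr /lebesgue_measure.
apply: le_mu_ext; exact: setSI.
Qed.

Lemma weakL1_norm_ge (g : R -> \bar R) (G : set R) (l c : R) : 0 < l ->
  (forall x, G x -> (l%:E < g x)%E) -> (c%:E <= torus_measure R G)%E ->
  ((l * c)%:E <= weakL1_norm g)%E.
Proof.
move=> l0 hG cG.
apply: (@le_trans _ _ (l%:E * torus_measure R [set x | l%:E < `|g x|])%E); last first.
  by apply: ereal_sup_ubound; exists l.
rewrite EFinM lee_pmul2l// (le_trans cG)//; apply: le_torus_measure => x /hG /= lg.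
by rewrite gee0_abs// ltW// (le_lt_trans _ lg)// lee_fin ltW.
Qed.

Lemma bounded_Lfun (f : R -> R) : bounded_measurable f ->
  f \in Lfun (torus_measure R) +oo%E.
Proof.
move=> [mf [M fM]]; rewrite inE; apply/andP; split; rewrite inE//=.
rewrite /finite_norm unlock /=; case: ifP => // _.
apply: (@le_lt_trans _ _ M%:E); last exact: ltry.
by apply/ess_supP; apply: nearW => x /=; rewrite lee_fin fM.
Qed.

(** The moments of the hypothesis are those of a variable with mean N L / 2 and
    variance at most N^2, and N^2 <= (N L / 4)^2 / 4 for L >= 8. *)
Lemma chebyshev_leaves (T : tower R) N L kap cnt mass : (8 <= L)%N -> (0 < N)%N ->
  tower_spec N L kap T cnt mass (N%:R * L%:R / 2)
    (N%:R * N%:R + (N%:R * L%:R / 2) ^+ 2) ->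
  2^-1 <= \sum_(u : T | N%:R * L%:R / 4 <= total_gain N u) width u.
Proof.
move=> L8 N0 specT; set a : R := N%:R * L%:R / 2.
have N0' : 0 < N%:R :> R by rewrite ltr0n.
have L8' : 8 <= L%:R :> R by rewrite ler_nat.
pose P (u : T) := N%:R * L%:R / 4 <= total_gain N u.
have var : \sum_(u : T) width u * (total_gain N u - a) ^+ 2 <= N%:R * N%:R.
  have -> : \sum_(u : T) width u * (total_gain N u - a) ^+ 2 =
    \sum_(u : T) (width u * total_gain N u ^+ 2 - 2 * a * (width u * total_gain N u)
       + width u * a ^+ 2) by apply: eq_bigr => u _; ring.
  rewrite big_split sumrB/= -mulr_sumr (moment1 specT) -mulr_suml (width_sum specT) mul1r.
  by have := moment2 specT; rewrite -/a; set s := \sum_(_ : T) _; nra.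
have bad : (\sum_(u : T | ~~ P u) width u) * (a / 2) ^+ 2 <=
    \sum_(u : T) width u * (total_gain N u - a) ^+ 2.
  rewrite [leRHS](bigID P)/= ler_wpDl//.
    by apply: sumr_ge0 => u _; rewrite mulr_ge0 ?sqr_ge0// ltW// (width_gt0 specT).
  rewrite mulr_suml; apply: ler_sum => u; rewrite /P -ltNge => Pu.
  rewrite ler_wpM2l ?(ltW (width_gt0 specT u))// -[leRHS]sqrrN.
  have a0 : 0 <= a by rewrite /a; nra.
  rewrite ler_sqr ?nnegrE; rewrite /a in a0 *; lra.
have tot := width_sum specT; rewrite (bigID P)/= in tot.
have a2 : 4 * (N%:R * N%:R) <= (a / 2) ^+ 2.
  have : 2 * N%:R <= a / 2 by rewrite /a; nra.
  by set b := a / 2; nra.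
have s0 : 0 <= \sum_(u : T | ~~ P u) width u.
  by apply: sumr_ge0 => u _; rewrite ltW// (width_gt0 specT).
have NN : 0 < N%:R * N%:R :> R by rewrite mulr_gt0.
move: bad var a2 tot s0 NN; rewrite -/(P _).
set s := \sum_(u : T | ~~ P u) _; set t := \sum_(u : T | P u) _.
set V := \sum_(_ : T) _; set NN := N%:R * N%:R; set A2 := (a / 2) ^+ 2.
move=> b1 b2 b3 b4 b5 b6.
have : s * (4 * NN) <= NN by rewrite (le_trans _ b2)// (le_trans _ b1)// ler_wpM2l.
rewrite mulrA ger_pMl// => s4.
rewrite -/t; lra.
Qed.

Variables (mu phi0 : cumulative R R).
Hypothesis wmu : lorentz_weight mu.
Hypothesis wphi : lorentz_weight phi0.

(** The constant 2^16 collects 2048 from the size of the operator and 32 from the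
    measure of the windows: 1/16 of the leaves with a large gain, which fill
    at least one half of the interval. *)
Lemma one_function L (n : nat -> nat) : (8 <= L)%N ->
  (forall s, 0 < s -> s <= (2 ^+ (L + 4))^-1 ->
     mu s = s * log2 (log2 (4 / s))) ->
  (forall s, 0 < s -> s <= (2 ^+ (L + 4))^-1 ->
     phi0 s = s * log2 (log2 (17 / s)) * log2 (log2 (log2 (log2 (17 / s))))) ->
  (n @ \oo --> \oo)%classic ->
  exists f : R -> R,
   [/\ [/\ periodic1 f, positive_function f & f \in Lfun (torus_measure R) +oo%E],
       ((128^-1)%:E <= lorentz_norm mu f <= 1%:E)%E,
       ((128^-1 * log2 (L + 2)%:R)%:E <= lorentz_norm phi0 f <= (4 * L%:R)%:E)%E &
       ((L%:R / 2 ^+ 16)%:E <= weakL1_norm (lac_carleson n f))%E].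
Proof.
move=> L8 muE phiE noo.
have L0 : (0 < L)%N by exact: leq_trans L8.
pose N := (2 ^ L)%N.
have N0 : (0 < N)%N by rewrite expn_gt0.
have NX : N%:R = 2 ^+ L :> R by rewrite /N natrX.
have [T [cnt0 [S0 _ _ cnt0b]]] := @tower_exists R N L N L0 (leqnn N).
(* Beyond the N layers of the tower, cnt is continued by values with the same
   bounds, to have geometric sequences without end. *)
pose cnt j := if (j < N)%N then cnt0 j else (2 ^ kappa L j)%N.
have cntb j : (2 ^ kappa L j <= cnt j <= 2 ^ (L + 2 * kappa L j))%N.
  rewrite /cnt; case: ifP => [|_]; first exact: cnt0b.
  by rewrite leqnn leq_exp2l//=; lia.
pose sz := @block_size R L cnt.
pose h := @block_height R L cnt.
pose bw := @block_weight R L.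
pose w i := bw i * 2 ^+ L.
have bw0 i : 0 < bw i by exact: block_weight_gt0.
have w0 i : 0 <= w i by rewrite mulr_ge0 ?exprn_ge0// ltW.
pose e : R := (2 ^+ (L + 10))^-1.
have e0 : 0 < e by rewrite invr_gt0 exprn_gt0.
have eE : e = (2 ^+ L)^-1 / 1024.
  have l0 : 2 ^+ L != 0 :> R by rewrite expf_neq0.
  by rewrite /e exprD; field.
have [nu [hint hop]] := tower_bound S0 w0 noo e0.
pose freq u := n (nu u).
rewrite -/freq in hint hop.
pose f := tower_fun N w freq.
pose E i := carrier_set freq i.
have mE i : measurable (E i) by exact: measurable_carrier_set.
have bf : bounded_measurable f by exact: bounded_measurable_tower_fun.
have mf : measurable_fun [set: R] f by case: bf.
have fE x : f x = \sum_(i < N) h i * \1_(E i) x.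
  apply: eq_bigr => i _; rewrite (layer_frac S0) /h /block_height -/(bw i) mulrA.
  by rewrite /cnt ltn_ord.
have h_ge0 i : 0 <= h i by rewrite ltW// block_height_gt0.
have sz_gt0 i : 0 < sz i by exact: block_size_gt0.
have Emeas i : (i < N)%N ->
  ((sz i / 2)%:E <= torus_measure R (E i) <= (2 * sz i)%:E)%E.
  move=> iN; rewrite /E (carrier_set_measure S0) !lee_fin.
  have := hint i iN; rewrite -mulr_suml (carries_mass S0) iN.
  set I := Rintegral _ _ _.
  have -> : sz i = (2 ^+ L)^-1 / 16 / 2 ^+ cnt0 i.
    rewrite /sz /block_size /cnt iN !exprD.
    have h1 : 2 ^+ cnt0 i != 0 :> R by rewrite expf_neq0.
    have h2 : 2 ^+ L != 0 :> R by rewrite expf_neq0.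
    by field; rewrite h1 h2.
  rewrite eE.
  have l0 : 0 < (2 ^+ L)^-1 :> R by rewrite invr_gt0 exprn_gt0.
  have c0 : 0 < (2 ^+ cnt0 i)^-1 :> R by rewrite invr_gt0 exprn_gt0.
  move: l0 c0; move: ((2 ^+ L)^-1 : R) ((2 ^+ cnt0 i)^-1 : R) => l c l0 c0.
  rewrite ler_norml => /andP[i1 i2].
  have i3 : l / 16 / 2 <= I by lra.
  have i4 : I <= 2 * (l / 16) by lra.
  have := ler_wpM2r (ltW c0) i3; have := ler_wpM2r (ltW c0) i4 => j1 j2.
  by apply/andP; split; lra.
have Ele i : (i < N)%N -> (torus_measure R (E i) <= (2 * sz i)%:E)%E.
  by move=> /Emeas/andP[].
have Ege i : (i < N)%N -> ((sz i / 2)%:E <= torus_measure R (E i))%E.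
  by move=> /Emeas/andP[].
have sz_le i : sz i <= (2 ^+ (L + 4))^-1 by exact: block_size_le.
have sz_16 i : sz i <= 16^-1.
  apply: (le_trans (sz_le i)); rewrite lef_pV2 ?posrE ?exprn_gt0//.
  rewrite (_ : 16 = 2 ^+ 4); last by rewrite -natrX.
  by rewrite ler_weXn2l ?ler1n// leq_addl.
have sz_1 i : sz i <= 1 by have := sz_16 i; lra.
have sz_4 : 4 * sz 0%N <= 1 by have := sz_16 0%N; lra.
have upper phi : lorentz_weight phi ->
    (lorentz_norm phi f <= (4 * \sum_(i < N) h i * phi (sz i))%:E)%E.
  move=> wp; apply: (lorentz_norm_le h_ge0 sz_gt0 mE mf fE) => //.
  exact: block_size_half.
have lower phi : lorentz_weight phi ->
    ((8^-1 * \sum_(i < N) h i * phi (sz i))%:E <= lorentz_norm phi f)%E.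
  move=> wp; apply: (lorentz_norm_ge h_ge0 sz_gt0 mE mf fE) => //.
  exact: block_height_double.
have msum := mu_sum cntb L0 (fun i => muE _ (sz_gt0 i) (sz_le i)).
have psum := phi_sum cntb L0 (fun i => phiE _ (sz_gt0 i) (sz_le i)).
exists f; split.
- split; last exact: bounded_Lfun.
  + by move=> x; rewrite /f /tower_fun frac_partD1.
  + split; first by move=> x; exact: tower_fun_ge0.
    apply: (@lt_le_trans _ _ (sz 0%N / 2)%:E); first by rewrite lte_fin divr_gt0.
    apply: (le_trans (Ege 0%N N0)); apply: le_torus_measure => x xE /=.
    rewrite gt_eqF// fE (bigD1 (Ordinal N0))//= indicE mem_set// mulr1.
    rewrite ltr_pwDl//; first exact: block_height_gt0.
    by apply: sumr_ge0 => k _; rewrite mulr_ge0// indicE.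
- have /andP[s1 s2] := msum; apply/andP; split.
    by apply: le_trans (lower mu wmu); rewrite lee_fin; lra.
  by apply: (le_trans (upper mu wmu)); rewrite lee_fin; lra.
- have /andP[s1 s2] := psum; apply/andP; split.
    by apply: le_trans (lower phi0 wphi); rewrite lee_fin; lra.
  apply: (le_trans (upper phi0 wphi)); rewrite lee_fin.
  have L8' : 8 <= L%:R :> R by rewrite ler_nat.
  move: s2; rewrite natrD natrM.
  by set s := \sum_(_ < _) _; lra.
have L8' : 8 <= L%:R :> R by rewrite ler_nat.
pose P (m : T) := N%:R * L%:R / 4 <= total_gain N m.
have -> : L%:R / 2 ^+ 16 = L%:R / 2048 * 32^-1 :> R by field.
apply: (@weakL1_norm_ge _ [set x | exists2 m, P m & window m x]).
- by lra.
- move=> x [m Pm wx]; apply: lt_le_trans (hop m x wx); rewrite lte_fin.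
  have piw i : (i < N)%N -> bw i * ((32 * pi)^-1 * (kappa L i)%:R * gain i m) <=
      w i * ((16 * pi)^-1 *
        \sum_(v : T | carries i v && (side i m v != None)) width v / reach m v).
    move=> iN; have := gain_le S0 i m; set G := \sum_(v | _) _ => hG.
    rewrite /w -[leRHS]mulrA ler_pM2l//.
    have pi0 := pi_gt0 R.
    rewrite [leRHS]mulrCA (_ : (32 * pi)^-1 * _ * _ =
        (16 * pi)^-1 * ((kappa L i)%:R / 2 * gain i m)).
      by rewrite ler_pM2l// invr_gt0 mulr_gt0.
    move: pi0; move: (pi : R) ((kappa L i)%:R : R) (gain i m) => a b c a0.
    by field; rewrite gt_eqF.
  have : (32 * pi)^-1 / N%:R * total_gain N m <=
    \sum_(i < N) w i * ((16 * pi)^-1 *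
        \sum_(v : T | carries i v && (side i m v != None)) width v / reach m v).
    rewrite /total_gain mulr_sumr; apply: ler_sum => i _.
    apply: le_trans (piw i (ltn_ord i)); rewrite /bw /block_weight -/N.
    rewrite le_eqVlt; apply/orP; left; apply/eqP.
    have k0 : (kappa L i)%:R != 0 :> R by rewrite pnatr_eq0 -lt0n kappa_gt0.
    have n0 : N%:R != 0 :> R by rewrite pnatr_eq0 -lt0n.
    have pi0 := pi_gt0 R.
    move: pi0 k0 n0.
    move: (pi : R) ((kappa L i)%:R : R) (N%:R : R) (gain i m) => a b c d a0 b0 c0.
    by field; rewrite b0 c0 (gt_eqF a0).
  set X := \sum_(i < N) _ => hX.
  have n0 : 0 < N%:R :> R by rewrite ltr0n.
  have pi0 := pi_gt0 R.
  have pi4 : pi < 4 :> R by have := pihalf_lt2 R; lra.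
  have : L%:R / 512 <= (32 * pi)^-1 / N%:R * total_gain N m.
    apply: (@le_trans _ _ ((32 * pi)^-1 / N%:R * (N%:R * L%:R / 4))); last first.
      by rewrite ler_wpM2l// divr_ge0 ?invr_ge0 ?mulr_ge0// ltW.
    have -> : (32 * pi)^-1 / N%:R * (N%:R * L%:R / 4) = L%:R / (128 * pi) :> R.
      move: pi0 n0; move: (pi : R) (N%:R : R) => a c a0 c0.
      by field; rewrite (gt_eqF a0) (gt_eqF c0).
    have p128 : 0 < 128 * pi :> R by lra.
    by rewrite ler_pM2l ?lef_pV2 ?posrE; lra.
  have e1 : e <= 1024^-1.
    have : (2 ^+ L)^-1 <= 1 :> R by rewrite invf_le1 ?exprn_gt0// exprn_ege1 ?ler1n.
    by rewrite eE; lra.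
  by move=> *; lra.
- apply: le_trans (windows_measure S0 P); rewrite lee_fin -mulr_suml.
  have S0' : tower_spec N L (kappa L) T cnt0
        (fun j => if (j < N)%N then (2 ^+ L)^-1 else 0) (N%:R * L%:R / 2)
        (N%:R * N%:R + (N%:R * L%:R / 2) ^+ 2).
    by apply: (tower_spec_eq S0) => //; rewrite lerD2r NX.
  by have := chebyshev_leaves L8 N0 S0'; rewrite -/P; lra.
Qed.

End assembly.

Theorem theorem2 (R : realType) (mu phi0 : cumulative R R)
  (hmu : weight_LloglogL mu) (hphi0 : weight_LloglogLloglogloglogL phi0) :
  exists C : R, 0 < C /\
    forall n : nat -> nat, lacunary R n ->
    exists f : nat -> R -> R,
      (forall k, [/\ periodic1 (f k), positive_function (f k)
                   & f k \in Lfun (torus_measure R) +oo%E]) /\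
      [/\ exists c c' : R, 0 < c /\ c <= c' /\
            forall k, (c%:E <= lorentz_norm mu (f k) <= c'%:E)%E,
          lorentz_norm phi0 (f k) @[k --> \oo] --> +oo%E
        & forall k,
            (C%:E * lorentz_norm phi0 (f k)
             <= weakL1_norm (lac_carleson n (f k)))%E].
Proof.
have [wmu [r1 /= r10 hr1]] := hmu; have [wphi [r2 /= r20 hr2]] := hphi0.
pose r := Num.min r1 r2.
have r0 : 0 < r by rewrite lt_min r10 r20.
(* From L0 on, the sizes of the layers are so small that both weights are given
   by their formulas. *)
pose L0 := (Num.truncn r^-1 + 8)%N.
have small k s : 0 < s -> s <= (2 ^+ (L0 + k + 4))^-1 -> s < r.
  move=> s0 sk; apply: (le_lt_trans sk).
  rewrite invf_plt ?posrE ?exprn_gt0//.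
  apply: (lt_le_trans (truncnS_gt _)); rewrite -natrX ler_nat.
  by apply: leq_trans (ltn_2expn _); rewrite ltnS /L0 -!addnA leq_addr.
have muE k s : 0 < s -> s <= (2 ^+ (L0 + k + 4))^-1 ->
    mu s = s * log2 (log2 (4 / s)).
  move=> s0 /(small k s s0) sr; apply: hr1 => //=.
  by rewrite sub0r normrN gtr0_norm// (lt_le_trans sr)// ge_min lexx.
have phiE k s : 0 < s -> s <= (2 ^+ (L0 + k + 4))^-1 ->
    phi0 s = s * log2 (log2 (17 / s)) * log2 (log2 (log2 (log2 (17 / s)))).
  move=> s0 /(small k s s0) sr; apply: hr2 => //=.
  by rewrite sub0r normrN gtr0_norm// (lt_le_trans sr)// ge_min lexx orbT.
exists ((2 ^+ 18)^-1); split; first by rewrite invr_gt0.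
move=> n /lacunary_cvg_infty noo.
have L8 k : (8 <= L0 + k)%N by rewrite /L0; lia.
have /choice [f hf] := fun k => one_function wmu wphi (L8 k) (muE k) (phiE k) noo.
exists f; split; first by move=> k; have [] := hf k.
split.
- exists (128^-1), 1; split; first by rewrite invr_gt0.
  split; first by rewrite invf_le1// ler1n.
  by move=> k; have [_ ] := hf k.
- apply/cvgeyPge => A; near=> k.
  have [_ _ /andP[+ _] _] := hf k; apply: le_trans; rewrite lee_fin.
  have hk : (2 ^ (Num.truncn (128 * A)).+1 <= k)%N.
    by near: k; exists (2 ^ (Num.truncn (128 * A)).+1)%N.
  have : (Num.truncn (128 * A)).+1%:R <= log2 (L0 + k + 2)%:R :> R.
    rewrite log2_ge_nat// -natrX ler_nat; lia.
  by have := truncnS_gt (128 * A); lra.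
- move=> k; have [_ _ /andP[_ u] +] := hf k; apply: le_trans.
  apply: (@le_trans _ _ (((2 ^+ 18)^-1)%:E * (4 * (L0 + k)%:R)%:E)%E).
    by rewrite lee_pmul2l// lte_fin invr_gt0.
  by rewrite -EFinM lee_fin; lra.
Unshelve. all: by end_near. Qed.
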